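(* Let $n\ge1$, $m\ge1$, $V=\mathbb{R}^{2n}$ with its standard symplectic form, and let $G=\mathrm{Sp}(2n,\mathbb{R})$ act diagonally on $V^{\times m}$. The field of symmetric rational invariants $\mathfrak{F}_G^m=\pi(\mathcal{F}_G^m)$ is the field of fractions of the algebra of symmetric polynomial invariants, $\mathfrak{F}_G^m=F(\mathcal{S}_G^m)$, and its transcendence degree over $\mathbb{R}$ is $$d(m,n)=\begin{cases}2nm-n(2n+1)&\text{for } m\ge 2n,\\ \binom m2&\text{for } m\le 2n.\end{cases}$$
   Context: $\mathcal{A}_G^m$ (resp. $\mathcal{F}_G^m$) denotes the algebra of $G$-invariant real polynomial (resp. the field of $G$-invariant real rational) functions on $V^{\times m}$. The symmetric group $S_m$ acts on $V^{\times m}$ by permuting the factors, commuting with $G$, and hence acts on $\mathcal{A}_G^m$ and $\mathcal{F}_G^m$. The averaging map is $\pi(f)=\frac1{m!}\sum_{\sigma\in S_m}\sigma\cdot f$. $\mathcal{S}_G^m=\pi(\mathcal{A}_G^m)\subset\mathcal{A}_G^m$ is the algebra of polynomial invariants of $\mathrm{Sp}(2n,\mathbb{R})\times S_m$ on $V^{\times m}$, and $\mathfrak{F}_G^m=\pi(\mathcal{F}_G^m)$ is the field of rational invariants of $\mathrm{Sp}(2n,\mathbb{R})\times S_m$ on $V^{\times m}$. $F(\cdot)$ denotes the field of fractions. *)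

(* Defs.v *)
From HB Require Import structures.
From mathcomp Require Import all_boot all_order all_fingroup all_algebra.
From mathcomp Require Import generic_quotient classical_sets reals.
From mathcomp Require Import mpoly.

Set Implicit Arguments.
Unset Strict Implicit.
Unset Printing Implicit Defensive.

Import GRing.Theory.
Local Open Scope ring_scope.
Local Open Scope classical_set_scope.

Local Notation "x %:F" := (@FracField.tofrac _ x).

Section FractionExtension.
Variable P : idomainType.

(* Extension of a ring endomorphism phi of P to Frac(P): p/q |-> phi p/phi q.
   By frac_extE it does not depend on the representative when phi is
   injective. *)
Definition frac_ext (phi : P -> P) (x : {fraction P}) : {fraction P} :=
  let r := repr x in (phi \n_r)%:F / (phi \d_r)%:F.

Lemma frac_repr (x : {fraction P}) :
  x = (\n_(repr x))%:F / (\d_(repr x))%:F.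
Proof.
have d0 : (\d_(repr x))%:F != 0 :> {fraction P}.
  by rewrite tofrac_eq0 denom_ratioP.
apply: (mulIf d0); rewrite divfK // -[X in X * _](@reprK _ {fraction P}).
set r := repr x; unlock FracField.tofrac.
rewrite -[LHS]FracField.pi_mul; apply/eqP; rewrite FracField.equivf_def.
rewrite /FracField.mulf !numden_Ratio ?mulr1 ?oner_neq0 ?denom_ratioP //.
by rewrite mulrC.
Qed.

Lemma frac_extE (phi : {rmorphism P -> P}) (p q : P) : injective phi ->
  q != 0 -> frac_ext phi (p%:F / q%:F) = (phi p)%:F / (phi q)%:F.
Proof.
move=> phi_inj q0; rewrite /frac_ext /=.
set x : {fraction P} := p%:F / q%:F; have := frac_repr x.
have d0 := denom_ratioP (repr x).
move: (frac _).1 (frac _).2 d0 => a b b0 /eqP.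
have phi0 c : c != 0 -> phi c != 0 by rewrite -(inj_eq phi_inj) rmorph0.
rewrite eqr_div ?tofrac_eq0 // -!tofracM tofrac_eq => /eqP e.
apply/eqP; rewrite eqr_div ?tofrac_eq0 ?phi0 // -!tofracM tofrac_eq -!rmorphM.
by rewrite e.
Qed.

End FractionExtension.

Section SymplecticInvariants.
Variables (R : realType) (n m : nat).

Definition symp_form : 'M[R]_(n + n) := block_mx 0 1%:M (- 1%:M) 0.

Definition symplectic : set 'M[R]_(n + n) :=
  [set A | A^T *m symp_form *m A = symp_form].

Lemma symplectic_unit A : symplectic A -> A \in unitmx.
Proof.
move=> symA; have JJ : symp_form *m (- symp_form) = 1%:M.
  rewrite mulmxN /symp_form mulmx_block opp_block_mx.
  rewrite !(mulmx0, mul0mx, mulmxN, mulNmx, mul1mx, mulmx1, add0r, addr0).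
  by rewrite !(oppr0, opprK) -scalar_mx_block.
have: (- symp_form *m A^T *m symp_form) *m A = 1%:M.
  by rewrite -!mulmxA [A^T *m _]mulmxA symA (mulmx1C JJ).
by case/mulmx1_unit.
Qed.

(* A point (v_1, ..., v_m) of V^m is the 2n x m matrix with columns v_j; the
   coordinate functions are the 'X_(mxvec_index i j). *)
Local Notation polyV := {mpoly R[(n + n) * m]}.
Local Notation ratV := {fraction {mpoly R[(n + n) * m]}}.

Definition mpeval (p : polyV) (M : 'M[R]_(n + n, m)) : R :=
  p.@[fun k => mxvec M 0 k].

Definition generic_point : 'M[polyV]_(n + n, m) :=
  \matrix_(i, j) 'X_(mxvec_index i j).

Definition pullback (Y : 'M[polyV]_(n + n, m)) (p : polyV) : polyV :=
  p \mPo [tuple mxvec Y 0 k | k < (n + n) * m].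

Definition sp_act (A : 'M[R]_(n + n)) : polyV -> polyV :=
  pullback (map_mx (@mpolyC _ R) (invmx A) *m generic_point).

Definition sym_act (s : 'S_m) : polyV -> polyV :=
  pullback (col_perm s generic_point).

Lemma mpeval_pullback Y p M :
  mpeval (pullback Y p) M = mpeval p (\matrix_(i, j) mpeval (Y i j) M).
Proof.
rewrite /mpeval /pullback comp_mpoly_meval; apply: meval_eq => k.
by rewrite tnth_mktuple; case/mxvec_indexP: k => i j; rewrite !mxvecE mxE.
Qed.

Lemma mpeval_generic i j M : mpeval (generic_point i j) M = M i j.
Proof. by rewrite mxE /mpeval mevalXU mxvecE. Qed.

Lemma mpeval_sp_act A p M : mpeval (sp_act A p) M = mpeval p (invmx A *m M).
Proof.
rewrite mpeval_pullback; congr mpeval; apply/matrixP => i j.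
rewrite !mxE /mpeval rmorph_sum; apply: eq_bigr => k _ /=.
by rewrite mevalM -[X in _ * X]/(mpeval (generic_point k j) M) mpeval_generic
           !mxE mevalC.
Qed.

Lemma mpeval_sym_act s p M : mpeval (sym_act s p) M = mpeval p (col_perm s M).
Proof.
rewrite mpeval_pullback; congr mpeval; apply/matrixP => i j.
by rewrite mxE [X in mpeval X]mxE mpeval_generic mxE.
Qed.

Lemma pullback_comp Y Z p :
  pullback Y (pullback Z p) = pullback (map_mx (pullback Y) Z) p.
Proof.
rewrite /pullback [p \mPo _]comp_mpolyEX [RHS]comp_mpolyEX raddf_sum /=.
apply: eq_bigr => u _; rewrite comp_mpolyZ !comp_mpolyX rmorph_prod /=.
congr (_ *: _); apply: eq_bigr => k _; rewrite rmorphXn /= !tnth_mktuple.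
by case/mxvec_indexP: k => i j; rewrite !mxvecE mxE.
Qed.

Lemma pullback_generic Y i j : pullback Y (generic_point i j) = Y i j.
Proof. by rewrite mxE /pullback comp_mpolyXU -tnth_nth tnth_mktuple mxvecE. Qed.

Lemma pullback_id p : pullback generic_point p = p.
Proof.
rewrite -[RHS]comp_mpoly_id /pullback; congr (_ \mPo _); apply: eq_from_tnth => k.
by rewrite !tnth_mktuple; case/mxvec_indexP: k => i j; rewrite mxvecE mxE.
Qed.

Lemma sp_actK A : A \in unitmx -> cancel (sp_act A) (sp_act (invmx A)).
Proof.
move=> uA p; rewrite /sp_act pullback_comp -[RHS]pullback_id; congr pullback.
have -> B Y : map_mx (pullback Y) (map_mx (@mpolyC _ R) B *m generic_point) =
           map_mx (@mpolyC _ R) B *m Y.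
  apply/matrixP => i j; rewrite !mxE /pullback raddf_sum; apply: eq_bigr => k _.
  rewrite /= rmorphM /= -[X in _ * X]/(pullback Y (generic_point k j)).
  by rewrite pullback_generic !mxE comp_mpolyC.
by rewrite invmxK mulmxA -map_mxM mulVmx // map_mx1 mul1mx.
Qed.

Lemma sym_actK s : cancel (sym_act s) (sym_act s^-1%g).
Proof.
move=> p; rewrite /sym_act pullback_comp -[RHS]pullback_id; congr pullback.
apply/matrixP => i j; rewrite mxE [X in pullback _ X]mxE pullback_generic.
by rewrite !mxE permK.
Qed.

Definition sp_actF (A : 'M[R]_(n + n)) : ratV -> ratV := frac_ext (sp_act A).
Definition sym_actF (s : 'S_m) : ratV -> ratV := frac_ext (sym_act s).

Lemma sp_actFE A p q : symplectic A -> q != 0 ->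
  sp_actF A (p%:F / q%:F) = (sp_act A p)%:F / (sp_act A q)%:F.
Proof.
by move=> /symplectic_unit uA; apply: frac_extE; apply: can_inj (sp_actK uA).
Qed.

Lemma sym_actFE s p q : q != 0 ->
  sym_actF s (p%:F / q%:F) = (sym_act s p)%:F / (sym_act s q)%:F.
Proof. by apply: frac_extE; apply: can_inj (sym_actK s). Qed.

Definition poly_invariants : set polyV :=
  [set p | forall A, symplectic A -> sp_act A p = p].

Definition rat_invariants : set ratV :=
  [set f | forall A, symplectic A -> sp_actF A f = f].

Definition average (p : polyV) : polyV :=
  (m`!%:R)^-1 *: \sum_(s : 'S_m) sym_act s p.

Definition averageF (f : ratV) : ratV :=
  (m`!%:R)^-1 * \sum_(s : 'S_m) sym_actF s f.

Definition sym_poly_invariants : set polyV := average @` poly_invariants.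

Definition sym_rat_invariants : set ratV := averageF @` rat_invariants.

End SymplecticInvariants.

Arguments symp_form : clear implicits.
Arguments symplectic : clear implicits.
Arguments poly_invariants : clear implicits.
Arguments rat_invariants : clear implicits.
Arguments sym_poly_invariants : clear implicits.
Arguments sym_rat_invariants : clear implicits.

(* The field of fractions of a subring S of P, inside Frac(P). *)
Definition fraction_field (P : idomainType) (S : set P) : set {fraction P} :=
  [set x | exists p q, [/\ S p, S q, q != 0 & x = p%:F / q%:F]].

Section TranscendenceDegree.
Variables (R : fieldType) (K : fieldType) (iota : {rmorphism R -> K}).

Definition alg_independent (d : nat) (t : 'I_d -> K) : Prop :=
  forall p : {mpoly R[d]}, mmap iota t p = 0 -> p = 0.

Definition adjoin (d : nat) (t : 'I_d -> K) : set K :=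
  [set x | exists p q : {mpoly R[d]},
     mmap iota t q != 0 /\ x = mmap iota t p / mmap iota t q].

Definition algebraic_over (E : set K) (x : K) : Prop :=
  exists P : {poly K}, [/\ P != 0, forall i, E P`_i & root P x].

(* The subfield E of K, which contains the image of R, has a transcendence
   basis over R of d elements. *)
Definition has_trdeg (E : set K) (d : nat) : Prop :=
  exists t : 'I_d -> K, [/\ forall i, E (t i), alg_independent t
    & forall x, E x -> algebraic_over (adjoin t) x].

End TranscendenceDegree.

Definition const_frac (R : fieldType) (k : nat) :
  {rmorphism R -> {fraction {mpoly R[k]}}} :=
  (@FracField.tofrac {mpoly R[k]}) \o (@mpolyC k R).

Arguments const_frac : clear implicits.

(* Main.v *)
Require Import Defs.
From HB Require Import structures.
From mathcomp Require Import all_boot all_order all_fingroup all_algebra.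
From mathcomp Require Import generic_quotient boolp classical_sets reals.
From mathcomp Require Import mpoly zify.

(** Let X be the generic 2n x m matrix over K = R(V^m) and omega i j the (i, j)
    entry of its Gram matrix X^T J X. Let E be the subfield of K generated by the
    omega i j with i < 2n. The first min(m, 2n) columns of X are independent; they
    extend to a basis B of K^2n whose Gram matrix is over E. By Gram-Schmidt over
    E, B has the same Gram matrix as some basis U with entries in E, so the
    map A with A B = U is symplectic over K and A X has entries in E. Evaluating
    A at real points shows that an invariant rational function p/q takes the same
    value at X and at A X; hence it lies in E. (Replacing A by A0 A for a suitable
    real symplectic A0 avoids the vanishing of q at A X, so that no unique
    factorization argument is needed.) This gives F_G = Frac(A_G), and the
    symmetric version follows by multiplying numerator and denominator by the
    conjugates of the denominator.

    The d(m, n) forms omega i j with i < j, i < 2n are algebraically independent,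
    since the Gram map is onto a dense open set of values. The symmetric
    polynomial invariants given by the coefficients of the product of all
    T - omega i j generate a field over which every omega i j is algebraic, so by
    the exchange lemma a maximal independent set of these coefficients is a
    transcendence basis with d(m, n) elements. *)

Set Implicit Arguments.
Unset Strict Implicit.
Unset Printing Implicit Defensive.

Import Order.TTheory GRing.Theory Num.Theory.
Local Open Scope ring_scope.
Local Open Scope classical_set_scope.

Local Notation "x %:F" := (@FracField.tofrac _ x).

(** * Closure operators *)

Section Matroid.
Variable T : eqType.
Implicit Types (A B : set T) (s : seq T).

Lemma set_cons x s : [set` x :: s] = [set` s] `|` [set x].
Proof.
apply/seteqP; split=> z /=; rewrite inE.
  by case/orP=> [/eqP->|]; [right|left].
by case=> [->|->]; rewrite ?eqxx ?orbT.
Qed.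

(** The axioms of a matroid closure. The dimension theory is abstract because the induction in
    [steinitz] replaces the operator by a contraction. *)
Record closure_operator (cl : set T -> set T) : Prop := ClosureOperator {
  closure_mem : forall A, A `<=` cl A;
  closure_trans : forall A B, B `<=` cl A -> cl B `<=` cl A;
  closure_exchange : forall A x y,
    cl (A `|` [set y]) x -> ~ cl A x -> cl (A `|` [set x]) y }.

Definition independent (cl : set T -> set T) A := forall x, A x -> ~ cl (A `\ x)
  x.

Lemma closure_mono cl A B : closure_operator cl -> A `<=` B -> cl A `<=` cl B.
Proof.
move=> clP AB; apply: (closure_trans clP).
by apply: subset_trans AB _; apply: closure_mem clP _.
Qed.

Lemma closure_contraction cl y :
  closure_operator cl -> closure_operator (fun A => cl (A `|` [set y])).
Proof.
move=> clP; split=> [A x Ax|A B BA|A x z].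
- by apply: (closure_mem clP); left.
- apply: (closure_trans clP) => x [/BA//|->].
  by apply: (closure_mem clP); right.
rewrite [_ `|` _ `|` _]setUAC [X in _ -> _ -> cl X _]setUAC.
exact: (closure_exchange clP).
Qed.

Lemma independentS cl A B :
  closure_operator cl -> A `<=` B -> independent cl B -> independent cl A.
Proof.
move=> clP AB Bi x Ax /(closure_mono clP (_ : A `\ x `<=` B `\ x)) clBx.
by apply: Bi (AB _ Ax) (clBx _) => z [/AB].
Qed.

(** If some [z] in [A] became dependent, exchanging [z] with [y] would put [y] in the closure of
    [A]. *)
Lemma independentU1 cl A y : closure_operator cl ->
  independent cl A -> ~ cl A y -> independent cl (A `|` [set y]).
Proof.
move=> clP Ai nAy z [Az|->] clz.
  have zy : z <> y by move=> zy; apply: nAy; rewrite -zy;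
    apply: closure_mem clP _ _ Az.
  apply: (nAy); apply: (closure_mono clP) (closure_exchange clP _ (Ai z Az)).
    by move=> x [[]//|->].
  by apply: (closure_mono clP) clz => x [[Ax|->] xz]; [left|right].
by apply: nAy; apply: (closure_mono clP) clz => x [[//|->] []].
Qed.

(* After exchanging one element y of ys into the spanning set, recurse in the
   contraction of the closure operator by y. *)
Lemma steinitz cl (xs ys : seq T) : closure_operator cl -> uniq ys ->
  independent cl [set` ys] -> [set` ys] `<=` cl [set` xs] ->
  (size ys <= size xs)%N.
Proof.
elim: xs cl ys => [|x xs IH] cl ys clP Uys Iys yx.
  case: ys Uys Iys yx => // y ys Uys Iys yx.
  have yy : y \in y :: ys by rewrite inE eqxx.
  by case: (Iys y yy); apply: (closure_mono clP) (yx y yy).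
have [yxs|] := pselect ([set` ys] `<=` cl [set` xs]).
  exact: leqW (IH cl ys clP Uys Iys yxs).
move=> /existsNP[y /not_implyP[/= yys nyxs]].
have xsE : [set` x :: xs] = [set` xs] `|` [set x].
    exact: set_cons.
have clx : cl ([set` xs] `|` [set y]) x.
  by apply: (closure_exchange clP) nyxs; rewrite -xsE; apply: yx.
rewrite (perm_size (perm_to_rem yys)) /= ltnS.
have remE : [set` rem y ys] = [set` ys] `\ y.
  apply/seteqP; split=> z /=; rewrite mem_rem_uniq // !inE.
    by case/andP=> /eqP.
  by case=> -> /eqP ->.
apply: IH (closure_contraction y clP) (rem_uniq _ Uys) _ _ => [z|z].
  rewrite remE => -[/= zys zy] clz; apply: (Iys z zys).
  apply: (closure_mono clP) clz => w [[[]]//|/= ->]; split=> //.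
  by move=> yz; apply: zy.
rewrite remE => -[/= zys _]; apply: (closure_trans clP) (yx z zys) => w.
by rewrite xsE => -[wxs|->//]; apply: (closure_mem clP); left.
Qed.

(** Greedy choice: an element is kept only if it lies outside the closure of those already kept. *)
Lemma exists_independent cl s : closure_operator cl -> exists t,
  [/\ uniq t, {subset t <= s}, independent cl [set` t] & [set` s] `<=` cl [set`
    t]].
Proof.
move=> clP; elim: s => [|x s [t [Ut ts It st]]].
  by exists [::]; split.
have ts' : {subset t <= x :: s} by move=> z /ts zs; rewrite inE zs orbT.
have [tx|ntx] := pselect (cl [set` t] x).
  by exists t; split=> // z /=; rewrite inE => /orP[/eqP->//|]; apply: st.
have tE : [set` x :: t] = [set` t] `|` [set x].
    exact: set_cons.
exists (x :: t); split.
- by rewrite /= Ut andbT; apply/negP => xt; apply: ntx;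
    apply: closure_mem clP _ _ xt.
- by move=> z; rewrite inE => /orP[/eqP->|/ts']; rewrite ?inE ?eqxx.
- by rewrite tE; apply: independentU1.
move=> z /=; rewrite tE inE => /orP[/eqP->|zs].
  by apply: (closure_mem clP); right.
apply: (closure_mono clP) (st z zs) => w; by left.
Qed.
End Matroid.

(** * Algebraic closure in a field *)

(** Closed predicates are made into field types so that the theory of [algebraicOver] along
    morphisms of fields applies. *)
Inductive subfield (F : fieldType) (S : divringClosed F) :=
  Subfield x & x \in S.

Section Subfield.
Variables (F : fieldType) (S : divringClosed F).
Definition subfield_val (u : subfield S) := let: Subfield x _ := u in x.
HB.instance Definition _ := [isSub for subfield_val].
HB.instance Definition _ := [Choice of subfield S by <:].
HB.instance Definition _ := [SubChoice_isSubIntegralDomain of subfield S by <:].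
HB.instance Definition _ := [SubIntegralDomain_isSubField of subfield S by <:].
End Subfield.

Section AlgebraicClosure.
Variables (R K : fieldType) (iota : {rmorphism R -> K}).

(** As an intersection of subfields this makes sense for infinite [A], and inclusions are proved by
    minimality. *)
Definition genfield (A : set K) : {pred K} := fun x =>
  `[< forall S : divringClosed K, (forall c, iota c \in S) ->
      (forall z, A z -> z \in S) -> x \in S >].

Lemma genfieldP (A : set K) x : reflect (forall S : divringClosed K,
  (forall c, iota c \in S) -> (forall z, A z -> z \in S) -> x \in S)
  (x \in genfield A).
Proof. exact: asboolP. Qed.

Lemma genfield_divring A : divring_closed (genfield A).
Proof.
split=> [|x y /genfieldP xA /genfieldP yA|x y /genfieldP xA /genfieldP yA];
  apply/genfieldP => S cS AS; rewrite ?rpred1 ?rpredB ?rpred_div ?xA ?yA //.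
Qed.

HB.instance Definition _ A :=
  GRing.isDivringClosed.Build K (genfield A) (genfield_divring A).

Lemma genfield_const A c : iota c \in genfield A.
Proof. by apply/genfieldP => S cS. Qed.

Lemma mem_genfield (A : set K) z : A z -> z \in genfield A.
Proof. by move=> Az; apply/genfieldP => S _; apply. Qed.

Lemma genfield_min (A : set K) (S : divringClosed K) x :
    (forall c, iota c \in S) -> (forall z, A z -> z \in S) ->
  x \in genfield A -> x \in S.
Proof. by move=> cS AS /genfieldP; apply. Qed.

Definition genval (A : set K) : {rmorphism subfield (genfield A) -> K} := val.

Definition alg_closure (A : set K) : set K :=
  [set x | algebraicOver (genval A) x].
End AlgebraicClosure.

Arguments genval : simpl never.

Section FractionImage.
Variables (D : comNzRingType) (K : fieldType) (phi : {rmorphism D -> K}).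

Definition frac_image : {pred K} := fun x =>
  `[< exists p q, phi q != 0 /\ x = phi p / phi q >].

Lemma frac_imageP x :
  reflect (exists p q, phi q != 0 /\ x = phi p / phi q) (x \in frac_image).
Proof. exact: asboolP. Qed.

Lemma frac_image_divring : divring_closed frac_image.
Proof.
split=> [|x y /frac_imageP[p [q [q0 ->]]] /frac_imageP[r [s [s0 ->]]]
         |x y /frac_imageP[p [q [q0 ->]]] /frac_imageP[r [s [s0 ->]]]];
  apply/frac_imageP.
- by exists 1, 1; rewrite rmorph1 oner_neq0 divr1.
- exists (p * s - r * q), (q * s); rewrite rmorphB !rmorphM mulf_neq0 //=.
  by split=> //; rewrite -[- (_ / _)]mulNr addf_div // mulNr.
(* Division by zero yields zero, which is represented as [0 / 1]. *)
have [r0|r0] := eqVneq (phi r) 0.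
  by exists 0, 1; rewrite r0 rmorph0 rmorph1 oner_neq0 !mul0r invr0 mulr0.
exists (p * s), (q * r); rewrite !rmorphM mulf_neq0 //; split=> //.
by rewrite invf_div mulf_div.
Qed.

HB.instance Definition _ :=
  GRing.isDivringClosed.Build K frac_image frac_image_divring.

Lemma frac_image_id p : phi p \in frac_image.
Proof. by apply/frac_imageP; exists p, 1; rewrite rmorph1 oner_neq0 divr1. Qed.

(** Induction on the Horner form; the common denominator is multiplied by that of the new constant
    coefficient. *)
Lemma clear_denominators (P : {poly K}) : (forall i, P`_i \in frac_image) ->
  exists c Q, phi c != 0 /\ phi c *: P = map_poly phi Q.
Proof.
elim/poly_ind: P => [_|P c IH PcE].
  by exists 1, 0; rewrite rmorph1 oner_neq0 scaler0 rmorph0.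
have [i|b [Q [b0 bE]]] := IH; first by have:= PcE i.+1;
  rewrite coefD coefMX coefC addr0.
have:= PcE 0%N; rewrite coefD coefMX coefC add0r => /frac_imageP[p [q [q0 ->]]].
exists (b * q), (q%:P * Q * 'X + (b * p)%:P).
rewrite !rmorphD !rmorphM /= !map_polyX !map_polyC /= mulf_neq0 //; split=> //.
rewrite scalerDr -bE -!mul_polyC !polyCM; congr (_ + _).
  by rewrite !mulrA [X in X * P]mulrC.
by rewrite -!polyCM [phi p / _]mulrC -mulrA mulVKf.
Qed.
End FractionImage.

Section AlgebraicClosureTheory.
Variables (R K : fieldType) (iota : {rmorphism R -> K}).
Implicit Types A B : set K.
Local Notation cl := (alg_closure iota).

Lemma alg_closureP A x : cl A x <->
  exists P : {poly K}, [/\ P != 0, forall i, P`_i \in genfield iota A & root P x].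
Proof.
split=> [[p p0 px]|[P [P0 PA Px]]].
  exists (map_poly (genval iota A) p); rewrite map_poly_eq0; split=> // i.
  by rewrite coef_map; exact: valP.
pose p : {poly subfield (genfield iota A)} :=
  \poly_(i < size P) Subfield (PA i).
have pP : map_poly (genval iota A) p = P.
  apply/polyP => i; rewrite coef_map coef_poly; case: ltnP => //= Pi.
  by rewrite nth_default.
by exists p; rewrite ?pP // -(map_poly_eq0 (genval iota A)) pP.
Qed.

Lemma mem_alg_closure A x : A x -> cl A x.
Proof.
move=> Ax; apply/alg_closureP; exists ('X - x%:P).
rewrite polyXsubC_eq0 root_XsubC; split=> // i.
rewrite coefB coefX coefC rpredB ?rpred_nat //.
by case: eqP => _; rewrite ?rpred0 // mem_genfield.
Qed.

Lemma genfield_alg_closure A x : x \in genfield iota A -> cl A x.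
Proof. by move=> xA; have:= algebraic_id (genval iota A) (Subfield xA). Qed.

Definition alg_pred A : {pred K} := fun x => `[< cl A x >].

Lemma alg_predP A x : reflect (cl A x) (x \in alg_pred A).
Proof. exact: asboolP. Qed.

Lemma alg_pred_divring A : divring_closed (alg_pred A).
Proof.
split=> [|x y /alg_predP xA /alg_predP yA|x y /alg_predP xA /alg_predP yA];
  apply/alg_predP; [exact: algebraic1|exact: algebraic_sub|exact: algebraic_div].
Qed.

HB.instance Definition _ A :=
  GRing.isDivringClosed.Build K (alg_pred A) (alg_pred_divring A).

(** The elements algebraic over [A] form a subfield, so coefficients generated by [B] are among
    them, and a root of a polynomial with algebraic coefficients is algebraic. *)
Lemma alg_closure_trans A B x : (forall z, B z -> cl A z) -> cl B x -> cl A x.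
Proof.
move=> BA /alg_closureP[P [P0 PB Px]]; apply/integral_algebraic.
apply: integral_root P0 Px _; apply/integral_poly => i; apply/integral_algebraic.
apply/alg_predP; apply: genfield_min (PB i) => [c|z /BA /alg_predP//].
by apply/alg_predP/genfield_alg_closure/genfield_const.
Qed.

Let ev A (y : K) : {rmorphism {poly subfield (genfield iota A)} -> K} :=
  horner_eval y \o map_poly (genval iota A).

Let evE A y p : ev A y p = (map_poly (genval iota A) p).[y].
Proof. by []. Qed.

Let evC A y c : ev A y c%:P = genval iota A c.
Proof. by rewrite evE map_polyC hornerC. Qed.

Lemma genfieldU1 A y z :
  z \in genfield iota (A `|` [set y]) -> z \in frac_image (ev A y).
Proof.
move=> zAy; apply: genfield_min zAy => [c|z' [Az|->]].
- rewrite -[iota c]/(genval iota A (Subfield (genfield_const iota A c))) -(evC y).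
  exact: frac_image_id.
- rewrite -[z']/(genval iota A (Subfield (mem_genfield iota Az))) -(evC y).
  exact: frac_image_id.
have {1}-> : y = ev A y 'X by rewrite evE map_polyX hornerX.
exact: frac_image_id.
Qed.

Lemma mem_genfieldU1 A y p : ev A y p \in genfield iota (A `|` [set y]).
Proof.
rewrite evE horner_coef rpred_sum // => i _.
apply: rpredM; last by apply: rpredX; apply: mem_genfield; right.
rewrite coef_map; have: genval iota A p`_i \in genfield iota A := valP p`_i.
apply: genfield_min => [c|z Az].
  exact: genfield_const.
by apply: mem_genfield; left.
Qed.

(* A relation Q(x, y) = 0 over the field generated by A is read as a polynomial
   equation for y, which is trivial only if x is algebraic over that field. *)
Lemma alg_closure_exchange A x y :
  cl (A `|` [set y]) x -> ~ cl A x -> cl (A `|` [set x]) y.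
Proof.
move=> /alg_closureP[P [P0 PA Px]] nAx.
have [i|c [Q [c0 QE]]] := @clear_denominators _ _ (ev A y) P.
  exact: genfieldU1.
have Q0 : Q != 0.
  by apply: contraNneq P0 => Q0; move: QE; rewrite Q0 rmorph0 => /eqP;
    rewrite scaler_eq0 (negPf c0).
pose Q' := map_poly (ev A x) (swapXY Q).
have Q'y : Q'.[y] = 0.
  have : (map_poly (ev A y) Q).[x] = 0 by rewrite -QE hornerZ (rootP Px) mulr0.
  rewrite /Q' /ev !map_poly_comp.
  rewrite -[map_poly (map_poly _) Q]swapXYK -horner_polyC horner2_swapXY.
  by rewrite horner_polyC swapXY_map.
have [Q'0|Q'0] := eqVneq Q' 0; last first.
  apply/alg_closureP; exists Q'; split=> // [i|]; last exact/rootP.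
  by rewrite coef_map; apply: mem_genfieldU1.
(* The coefficients of [Q'] are those of [swapXY Q] evaluated at [x]. The leading one is a nonzero
   polynomial over the field of [A], and it now vanishes at [x]. *)
case: nAx; exists (swapXY Q)`_(size (swapXY Q)).-1.
  by rewrite lead_coef_eq0 swapXY_eq0.
apply/rootP; have:= congr1 (fun p : {poly K} => p`_(size (swapXY Q)).-1) Q'0.
by rewrite coef_map coef0.
Qed.

End AlgebraicClosureTheory.

(** * Algebraic independence *)

Lemma alg_closure_operator (R K : fieldType) (iota : {rmorphism R -> K}) :
  closure_operator (alg_closure iota).
Proof.
split=> [A x|A B BA x|A x y]; first exact: mem_alg_closure.
  exact: alg_closure_trans.
exact: alg_closure_exchange.
Qed.

Lemma mpoly_rmorph_eq (R : comNzRingType) (S : nzRingType) (n : nat)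
    (f g : {rmorphism {mpoly R[n]} -> S}) :
    (forall c, f c%:MP = g c%:MP) -> (forall i, f 'X_i = g 'X_i) -> f =1 g.
Proof.
move=> fgC fgX p; rewrite [p]mpolyE !rmorph_sum; apply: eq_bigr => m _ /=.
rewrite -mul_mpolyC !rmorphM /= fgC mpolyXE_id !rmorph_prod; congr (_ * _).
by apply: eq_bigr => i _; rewrite !rmorphXn /= fgX.
Qed.

(** * Multivariate polynomials as polynomials in the last variable *)

Section Muni.
Variables (R : comNzRingType) (n : nat).
Local Notation widen := (widen_ord (leqnSn n)).

Lemma muniX_max : muni 'X_ord_max = 'X :> {poly {mpoly R[n]}}.
Proof.
rewrite muniE msuppX big_seq1 mcoeffX eqxx mnm1E eqxx expr1 scale1r.
rewrite [X in 'X_[X]](_ : _ = 0%MM) ?mpolyX0 ?scale1r //.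
apply/mnmP => i; rewrite mnmE mnm1E mnm0E; case: eqP => // /(congr1 val) /=.
by move=> ni; have := ltn_ord i; rewrite -ni ltnn.
Qed.

Lemma muniX_widen i : muni 'X_(widen i) = ('X_i)%:P :> {poly {mpoly R[n]}}.
Proof.
rewrite muniE msuppX big_seq1 mcoeffX eqxx mnm1E scale1r.
rewrite [(_ == _)](_ : _ = false) ?expr0; last first.
  by apply/eqP => /(congr1 val) /= ni; have := ltn_ord i; rewrite ni ltnn.
rewrite [X in 'X_[X]](_ : _ = U_(i)%MM) ?alg_polyC //.
by apply/mnmP => j; rewrite mnmE !mnm1E -val_eqE.
Qed.

Lemma ord_recr_ind (P : 'I_n.+1 -> Prop) :
  P ord_max -> (forall i, P (widen i)) -> forall i, P i.
Proof.
move=> Pm Pw i; have [ni|] := ltnP i n.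
  by rewrite (_ : i = widen (Ordinal ni)) //; apply: val_inj.
move=> ni; rewrite (_ : i = ord_max) //; apply: val_inj => /=.
by apply/eqP; rewrite eqn_leq ni -ltnS ltn_ord.
Qed.

Lemma mmap_muni (S : comNzRingType) (f : {rmorphism R -> S}) (t : 'I_n.+1 -> S)
  p :
  mmap f t p = (map_poly (mmap f (t \o widen)) (muni p)).[t ord_max].
Proof.
pose g : {rmorphism {mpoly R[n.+1]} -> S} :=
  horner_eval (t ord_max) \o map_poly (mmap f (t \o widen)) \o @muni n R.
rewrite -[RHS]/(g p); apply: (mpoly_rmorph_eq (f := mmap f t)) => [c|i] /=.
  by rewrite muniC mmapC map_polyC /= mmapC /horner_eval hornerC.
rewrite /horner_eval mmapX mmap1U; elim/ord_recr_ind: i => [|i].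
  by rewrite muniX_max map_polyX hornerX.
by rewrite muniX_widen map_polyC /= mmapX mmap1U hornerC.
Qed.

(** Substituting the variables for themselves recovers [p], and by [mmap_muni] this substitution
    factors through [muni p]. *)
Lemma muni_eq0 (p : {mpoly R[n.+1]}) : muni p = 0 -> p = 0.
Proof.
move=> p0; have := @mmap_muni {mpoly R[n.+1]} (@mpolyC _ R) (fun i => 'X_i) p.
rewrite p0 map_poly0 horner0 => <-; rewrite -[LHS]comp_mpoly_id /comp_mpoly.
by rewrite /mmap; apply: eq_bigr => m _; congr (_ * _); apply: mmap1_eq => i;
  rewrite tnth_mktuple.
Qed.

Lemma muni_surj (Q : {poly {mpoly R[n]}}) : exists p, muni p = Q.
Proof.
exists (map_poly (@mwiden n R) Q).['X_ord_max].
have mw q : muni (mwiden q) = q%:P :> {poly {mpoly R[n]}}.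
  rewrite -[LHS]/((@muni n R \o @mwiden n R) q).
  apply: (mpoly_rmorph_eq (f := @muni n R \o @mwiden n R) (g := polyC)) => [c|i]
    /=.
    by rewrite mwidenC muniC.
  by rewrite /mwiden mmapX mmap1U muniX_widen.
elim/poly_ind: Q => [|Q c IH]; first by rewrite map_poly0 horner0 muni0.
rewrite rmorphD rmorphM /= map_polyX map_polyC /= hornerMXaddC.
by rewrite muniD muniM IH muniX_max mw.
Qed.
End Muni.

Section AlgebraicIndependence.
Variables (R K : fieldType) (iota : {rmorphism R -> K}).
Local Notation cl := (alg_closure iota).

Lemma mmap_divring n (S : divringClosed K) (t : 'I_n -> K) p :
  (forall c, iota c \in S) -> (forall i, t i \in S) -> mmap iota t p \in S.
Proof.
move=> cS tS; apply: rpred_sum => m _; rewrite rpredM //.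
by apply: rpred_prod => i _; apply: rpredX.
Qed.

Lemma genfield_range n (t : 'I_n -> K) x :
  x \in genfield iota (range t) <-> adjoin iota t x.
Proof.
split=> [xt|[p [q [q0 ->]]]]; last first.
  by rewrite rpred_div // mmap_divring // => [c|i|c|i];
    rewrite ?genfield_const ?mem_genfield.
apply/(frac_imageP (mmap iota t)); apply: genfield_min xt => [c|_ [i _ <-]].
  by rewrite -[iota c](mmapC t); apply: frac_image_id.
by rewrite -[t i](mmap1U t) -(mmapX t iota); apply: frac_image_id.
Qed.

Lemma algebraic_over_adjoin n (t : 'I_n -> K) x :
  algebraic_over (adjoin iota t) x <-> cl (range t) x.
Proof.
by split=> [[P [P0 Pt Px]]|/alg_closureP[P [P0 Pt Px]]]; first apply/alg_closureP;
  exists P; split=> // i; apply/genfield_range.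
Qed.

Lemma range_ordS n (t : 'I_n.+1 -> K) :
  range t = range (t \o widen_ord (leqnSn n)) `|` [set t ord_max].
Proof.
apply/seteqP; split=> [_ [i _ <-]|x].
  by elim/ord_recr_ind: i => [|i]; [right|left; exists i].
by case=> [[i _ <-]|->]; [exists (widen_ord (leqnSn n) i)|exists ord_max].
Qed.

(** Through [muni], a relation between all the elements is a polynomial equation for the last one
    over the field of the others. This is the bridge to matroid independence, crossed by induction
    in both directions below. *)
Lemma alg_independentS n (t : 'I_n.+1 -> K) :
  alg_independent iota t <->
  alg_independent iota (t \o widen_ord (leqnSn n)) /\
  ~ cl (range (t \o widen_ord (leqnSn n))) (t ord_max).
Proof.
set t' := t \o _; split=> [tI|[t'I nclt] p].
  have map0 Q : (map_poly (mmap iota t') Q).[t ord_max] = 0 -> Q = 0.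
    case: (muni_surj Q) => p <-; rewrite -mmap_muni => /tI ->.
    by rewrite muni0.
  split=> [p p0|/alg_closureP[P [P0 Pt Px]]].
    apply/polyC_inj/map0; by rewrite map_polyC /= p0 hornerC.
  have [i|c [Q [c0 QE]]] := @clear_denominators _ _ (mmap iota t') P.
    by apply/frac_imageP/genfield_range.
  have Q0 : Q = 0 by apply: map0; rewrite -QE hornerZ (rootP Px) mulr0.
  move/eqP: QE; rewrite Q0 rmorph0 scaler_eq0 (negPf c0) /=.
  exact/negP.
rewrite mmap_muni -/t' => px; apply: muni_eq0.
have [p0|p0] := eqVneq (map_poly (mmap iota t') (muni p)) 0.
  apply/polyP => i; rewrite coef0; apply: t'I.
  by rewrite -coef_map p0 coef0.
case: nclt; apply/alg_closureP; exists (map_poly (mmap iota t') (muni p)).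
split=> // [i|]; last exact/rootP.
by rewrite coef_map mmap_divring // => [c|j];
  rewrite ?genfield_const ?mem_genfield.
Qed.

Lemma alg_independent_inj n (t : 'I_n -> K) : alg_independent iota t ->
  injective t.
Proof.
move=> tI i j tij; have: 'X_i - 'X_j = 0 :> {mpoly R[n]}.
  by apply: tI; rewrite rmorphB /= !mmapX !mmap1U tij subrr.
move/eqP; rewrite subr_eq0 => /eqP/(congr1 (mcoeff U_(i))).
rewrite !mcoeffX eqxx; case: eqP => [/mnmP/(_ i)|_ /eqP];
  last by rewrite oner_eq0.
by rewrite !mnm1E eqxx; case: eqP.
Qed.

Lemma alg_independent_closure n (t : 'I_n -> K) :
  alg_independent iota t -> independent cl (range t).
Proof.
elim: n t => [|n IH] t; first by move=> _ _ [[i ni]] //.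
rewrite range_ordS => /alg_independentS[/IH]; apply: independentU1.
exact: alg_closure_operator.
Qed.

(** The range of [t] forgets repetitions, hence the separate injectivity assumption. *)
Lemma closure_alg_independent n (t : 'I_n -> K) :
  injective t -> independent cl (range t) -> alg_independent iota t.
Proof.
have clP := alg_closure_operator iota.
elim: n t => [|n IH] t t_inj tI.
  move=> p; rewrite [p]nvar0_mpolyC mmapC => /eqP.
  by rewrite fmorph_eq0 => /eqP ->.
apply/alg_independentS; split.
  apply: IH => [i j /t_inj /(congr1 val) /= ij|]; first exact: val_inj.
  by apply: independentS tI => //; rewrite range_ordS; left.
move=> clt; apply: (tI (t ord_max)); first by exists ord_max.
apply: closure_mono clt => // _ [i _ <-]; split;
  first by exists (widen_ord (leqnSn n) i).
by move=> /= /t_inj /(congr1 val) /= ni; have := ltn_ord i; rewrite ni ltnn.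
Qed.
End AlgebraicIndependence.

(** * Transcendence bases extracted from finite families *)

Section TranscendenceBasis.
Variables (R K : fieldType) (iota : {rmorphism R -> K}).
Local Notation cl := (alg_closure iota).

Lemma range_tnth n (t : n.-tuple K) : range (tnth t) = [set` t].
Proof.
apply/seteqP; split=> [_ [i _ <-]|x /= /tnthP[i ->]]; first exact: mem_tnth.
by exists i.
Qed.

(** The family [a] may lie outside [E]; it measures the size. A maximal independent part [t] of [s]
    and the family [a] lie in the closure of each other, so [steinitz] in both directions gives [t]
    exactly [d] elements, all in [E]. *)
Lemma has_trdeg_finite (E : set K) d (a : 'I_d -> K) (s : seq K) :
    alg_independent iota a -> (forall x, E x -> cl (range a) x) ->
    {in s, forall x, E x} -> (forall i, cl [set` s] (a i)) ->
  has_trdeg iota E d.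
Proof.
move=> aI Ea sE sa; have clP := alg_closure_operator iota.
have [t [Ut ts tI st]] := exists_independent s clP.
have ta x : cl (range a) x -> cl [set` t] x.
  apply: alg_closure_trans => _ [i _ <-].
  exact: alg_closure_trans (sa i).
pose b := [tuple a i | i < d].
have bE : range a = [set` b].
  by rewrite -range_tnth (_ : tnth b = a) //; apply/funext => i;
    rewrite tnth_mktuple.
have Ub : uniq b by rewrite map_inj_uniq ?enum_uniq //;
  apply: alg_independent_inj aI.
have dt : d = size t.
  rewrite -[LHS](size_tuple b); apply/eqP; rewrite eqn_leq; apply/andP; split.
    apply: (steinitz clP) => //.
      by rewrite -bE; apply: alg_independent_closure.
    by rewrite -bE => x ax; apply/ta/mem_alg_closure.
  by apply: (steinitz clP) => // x /ts /sE /Ea; rewrite bE.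
rewrite dt; exists (tnth (in_tuple t)); split=> [i||x Ex].
- by apply/sE/ts; apply: mem_tnth.
- apply: closure_alg_independent; last by rewrite range_tnth.
  exact/tuple_uniqP.
by apply/algebraic_over_adjoin; rewrite range_tnth; apply/ta/Ea.
Qed.
End TranscendenceBasis.

(** * Symplectic forms *)

(** The matrix [symp_form] over an arbitrary ring: it is used over the polynomial ring and the
    function field as well as over the reals. *)
Definition sympJ (F : pzRingType) n : 'M[F]_(n + n) := block_mx 0 1%:M (- 1%:M) 0.

Section SympJ.
Variable F : fieldType.

Lemma sympJ_sqr n : sympJ F n *m sympJ F n = - 1%:M.
Proof.
rewrite /sympJ mulmx_block [in RHS]scalar_mx_block opp_block_mx.
by rewrite !(mulmx0, mul0mx, mulmxN, mulNmx, mul1mx, mulmx1, add0r, addr0, oppr0).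
Qed.

Lemma sympJ_unit n : sympJ F n \in unitmx.
Proof.
have : sympJ F n *m - sympJ F n = 1%:M by rewrite mulmxN sympJ_sqr opprK.
by case/mulmx1_unit.
Qed.

Lemma tr_sympJ n : (sympJ F n)^T = - sympJ F n.
Proof.
by rewrite /sympJ tr_block_mx opp_block_mx !trmx0 [(- _)^T]raddfN /= trmx1
  !oppr0 opprK.
Qed.

Lemma gram_col_mxE n k l (P Q : 'M[F]_(n, k)) (P' Q' : 'M[F]_(n, l)) i j :
  ((col_mx P Q)^T *m sympJ F n *m col_mx P' Q') i j =
    \sum_h (P h i * Q' h j - Q h i * P' h j).
Proof.
rewrite tr_col_mx mul_row_block mulmx0 mulmx1 mulmxN mulmx1 mulmx0 add0r addr0.
rewrite mul_row_col mulNmx addrC !mxE -sumrB; apply: eq_bigr => h _.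
by rewrite !mxE.
Qed.

Lemma gram_alternating n k (Y : 'M[F]_(n + n, k)) :
  let W := Y^T *m sympJ F n *m Y in W^T = - W /\ forall i, W i i = 0.
Proof.
split=> [|i].
  by rewrite !trmx_mul trmxK tr_sympJ mulNmx mulmxN mulmxA.
rewrite -[Y]vsubmxK gram_col_mxE big1 // => h _.
by rewrite mulrC subrr.
Qed.

Lemma det_mxOver (S : divringClosed F) n (A : 'M[F]_n) :
  A \is a mxOver S -> \det A \in S.
Proof.
move=> /mxOverP AS; apply: rpred_sum => s _; rewrite rpredMsign.
by apply: rpred_prod.
Qed.

Lemma mxOver_invmx (S : divringClosed F) n (A : 'M[F]_n) :
  A \is a mxOver S -> invmx A \is a mxOver S.
Proof.
move=> AS; rewrite /invmx; case: ifP => // _; apply/mxOverP => i j.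
rewrite !mxE rpredM ?rpredV ?det_mxOver // rpredMsign det_mxOver //.
by apply/mxOverP => k l; rewrite !mxE (mxOverP AS).
Qed.

(* Splitting off a hyperbolic plane: if W a b != 0, subtracting the rank two
   form built from the columns a and b kills both columns. *)
Lemma alternating_sum (S : divringClosed F) k n (T : {set 'I_k}) (W : 'M[F]_k) :
    (#|T| <= n.*2)%N -> W^T = - W -> (forall i, W i i = 0) ->
    W \is a mxOver S -> (forall i j, i \notin T -> W i j = 0) ->
  exists P Q : nat -> 'I_k -> F,
    [/\ forall l i, P l i \in S, forall l i, Q l i \in S &
      forall i j, W i j = \sum_(l < n) (P l i * Q l j - Q l i * P l j)].
Proof.
elim: n T W => [|n IH] T W Tn Wt W0 WS WT.
  exists (fun=> fun=> 0), (fun=> fun=> 0); split=> [_ _|_ _|i j];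
    rewrite ?rpred0 //.
  by move: Tn; rewrite leqn0 cards_eq0 => /eqP T0; rewrite big_ord0 WT // T0 inE.
have Wa i j : W i j = - W j i by move/matrixP/(_ j i): Wt; rewrite !mxE.
have [[a b] /= w0|Wz] := pickP (fun p : 'I_k * 'I_k => W p.1 p.2 != 0);
  last first.
  exists (fun=> fun=> 0), (fun=> fun=> 0); split=> [_ _|_ _|i j];
    rewrite ?rpred0 //.
  rewrite big1 => [|l _]; last by rewrite mulr0 subrr.
  by have /eqP := Wz (i, j).
pose x i := W i b / W a b; pose y j := W a j.
pose W' := \matrix_(i, j) (W i j - (x i * y j - y i * x j)).
have aT : a \in T by apply: contraNT w0 => /WT ->.
have bT : b \in T by apply: contraNT w0 => /WT Wb; rewrite Wa Wb oppr0.
have ab : b != a by apply: contraNneq w0 => ->; rewrite W0.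
have [|||||P [Q [PS QS W'E]]] := IH (T :\ a :\ b) W'.
- move: Tn; rewrite (cardsD1 a) aT (cardsD1 b (T :\ a)) in_setD1 ab bT.
  by rewrite doubleS !addSn !ltnS add0n.
- apply/matrixP => i j; rewrite !mxE (Wa j i) [RHS]opprB [RHS]addrC opprB.
  by rewrite [y j * _]mulrC [x j * _]mulrC.
- by move=> i; rewrite !mxE W0 /x /y mulrC subrr subr0.
- by apply/mxOverP => i j;
    rewrite !mxE /x /y !(rpredB, rpredM, rpredV) ?(mxOverP WS).
- move=> i j; rewrite !in_setD1 => niT; rewrite !mxE /x /y.
  have [->|ib] := eqVneq i b.
    by rewrite W0 mul0r mul0r sub0r opprK mulrC divfK // [W j b]Wa subrr.
  have [->|ia] := eqVneq i a.
    by rewrite divff // mul1r W0 mul0r subr0 subrr.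
  have iT : i \notin T by move: niT; rewrite ib ia.
  by rewrite (Wa a i) !(WT i) // oppr0 !mul0r !subrr.
(* Indexing by [nat] lets the new plane sit at index [n] while the earlier ones keep their
   indices. *)
exists (fun l => if l == n then x else P l), (fun l => if l == n then y else Q l).
split=> [l i|l i|i j].
- by case: ifP => // _; rewrite rpred_div ?(mxOverP WS).
- by case: ifP => // _; rewrite ?(mxOverP WS).
rewrite big_ord_recr /= eqxx.
have := W'E i j; rewrite mxE => /eqP; rewrite subr_eq => /eqP ->; congr (_ + _).
by apply: eq_bigr => l _; rewrite ltn_eqF.
Qed.

(** At most [n] hyperbolic planes over [S] make up [W], because [k <= n + n]; their two families of
    vectors are the upper and lower halves of [N]. *)
Lemma alternating_gram (S : divringClosed F) k n (W : 'M[F]_k) :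
    (k <= n + n)%N -> W^T = - W -> (forall i, W i i = 0) -> W \is a mxOver S ->
  exists2 N : 'M[F]_(n + n, k), N \is a mxOver S & N^T *m sympJ F n *m N = W.
Proof.
move=> kn Wt W0 WS.
have [|i j|P [Q [PS QS WE]]] := @alternating_sum S k n [set: 'I_k]%SET W _ Wt W0
  WS.
- by rewrite cardsT card_ord -addnn.
- by rewrite inE.
exists (col_mx (\matrix_(l, i) P l i) (\matrix_(l, i) Q l i)).
  by apply/mxOverP => l i; rewrite mxE; case: splitP => h _; rewrite mxE.
apply/matrixP => i j; rewrite gram_col_mxE WE.
by apply: eq_bigr => l _; rewrite !mxE.
Qed.

Local Notation gramr Y := (Y *m sympJ F _ *m Y^T).

Lemma row_free_col_mx k n (Y : 'M[F]_(k, n)) (v : 'rV_n) :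
  row_free Y -> ~~ (v <= Y)%MS -> row_free (col_mx Y v).
Proof.
move=> Yf vY; apply/inj_row_free => u; rewrite -[u]hsubmxK mul_row_col.
set u1 := lsubmx u; set u2 := rsubmx u; rewrite (mx11_scalar u2) mul_scalar_mx.
have [->|u0] := eqVneq (u2 0 0) 0.
  rewrite scale0r addr0 => /eqP; rewrite mulmx_free_eq0 // => /eqP ->.
  by rewrite raddf0 row_mx0.
move=> e; case/negP: vY; rewrite -(eqmx_scale _ u0).
have -> : u2 0 0 *: v = - u1 *m Y.
  by apply/eqP; rewrite mulNmx -addr_eq0 addrC e.
exact: submxMl.
Qed.

(* The vectors whose pairings with Y are 0, or 1 on one row and 0 on the others,
   span the whole space, so one of them lies outside the row space of Y. *)
Lemma extend_gram_step (S : divringClosed F) k n (Y : 'M[F]_(k, n + n)) :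
    (k < n + n)%N -> row_free Y -> exists2 v : 'rV_(n + n),
  ~~ (v <= Y)%MS & Y *m sympJ F n *m v^T \is a mxOver S.
Proof.
move=> kn Yf; set Z := Y *m sympJ F n.
have /row_freeP[V ZV] : row_free Z.
  by rewrite /row_free mxrankMfree ?row_free_unit ?sympJ_unit.
have [VY|/row_subPn[i Vi]] := boolP (V^T <= Y)%MS; last first.
  exists (row i V^T) => //; rewrite tr_row trmxK colE mulmxA ZV mul1mx.
  by apply/mxOverP => p q; rewrite mxE rpred_nat.
have [kY|/row_subPn[i ki]] := boolP (kermx Z^T <= Y)%MS; last first.
  exists (row i (kermx Z^T)) => //.
  have : row i (kermx Z^T) *m Z^T = 0 by rewrite -row_mul mulmx_ker raddf0.
  move/(congr1 trmx); rewrite trmx_mul trmxK trmx0 => ->.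
  by apply/mxOverP => p q; rewrite mxE rpred0.
have : row_full Y.
  (* Every row vector is the sum of one orthogonal to [Y] and a combination of the dual vectors. If
     both kinds lay in the row space of [Y], its rank would be [n + n]. *)
  rewrite -sub1mx -[1%:M](subrK (Z^T *m V^T)) addmx_sub //.
    apply: submx_trans kY; apply/sub_kermxP.
    by rewrite mulmxBl mul1mx -mulmxA -trmx_mul ZV trmx1 mulmx1 subrr.
  exact: submx_trans (submxMl _ _) VY.
by rewrite /row_full (eqP Yf) ltn_eqF.
Qed.

(** Vectors from [extend_gram_step] are appended one by one; their self-pairings vanish. The last
    two conclusions compare rows, which avoids casts along [k = n + n]. *)
Lemma extend_gram (S : divringClosed F) k n (Y : 'M[F]_(k, n + n)) :
    (k <= n + n)%N -> row_free Y -> gramr Y \is a mxOver S ->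
  exists B : 'M[F]_(n + n), [/\ B \in unitmx, gramr B \is a mxOver S,
    forall i, exists i', row i Y = row i' B
    & k = (n + n)%N -> forall i', exists i, row i' B = row i Y].
Proof.
move kd: (n + n - k)%N => d; elim: d k kd Y => [|d IH] k kd Y kn Yf YS.
  have kE : k = (n + n)%N by apply/eqP; rewrite eqn_leq kn -subn_eq0 kd.
  subst k; exists Y; split=> // [|i|_ i];
    [by rewrite -row_free_unit|by exists i..].
have kn' : (k < n + n)%N by rewrite -subn_gt0 kd.
have [v vY vS] := extend_gram_step S kn' Yf.
have vJY : v *m sympJ F n *m Y^T \is a mxOver S.
  have -> : v *m sympJ F n *m Y^T = - (Y *m sympJ F n *m v^T)^T.
    by rewrite !trmx_mul trmxK tr_sympJ mulNmx mulmxN opprK mulmxA.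
  by rewrite rpredN; apply/mxOverP => i j; rewrite mxE (mxOverP vS).
have vJv : v *m sympJ F n *m v^T = 0.
  have [_ W0] := gram_alternating v^T; rewrite trmxK in W0.
  by apply/matrixP => i j; rewrite !ord1 W0 mxE.
have [||||B [Bu BS YB _]] := IH (k + 1)%N _ (col_mx Y v).
- by rewrite addn1 subnS kd.
- by rewrite addn1.
- exact: row_free_col_mx.
- rewrite tr_col_mx mul_col_mx mul_col_row vJv.
  apply/mxOverP => i j; rewrite mxE; case: splitP => p _; rewrite mxE;
    by case: splitP => q _;
      rewrite ?(mxOverP YS) ?(mxOverP vS) ?(mxOverP vJY) ?mxE ?rpred0.
exists B; split=> // [i|kE]; last by rewrite kE ltnn in kn'.
have [i' iE] := YB (lshift 1 i); exists i'.
by rewrite -iE rowKu.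
Qed.

(* If U has the same Gram matrix as B, the map sending the rows of B to those of
   U is symplectic; it sends x to a vector determined by the pairings of x with
   the rows of B. *)
Lemma symplectic_descent (S : divringClosed F) m n (X : 'M[F]_(n + n, m)) :
    let W := X^T *m sympJ F n *m X in
    (forall i j : 'I_m, (i < n + n)%N -> W i j \in S) ->
    row_free (\matrix_(i < minn m (n + n)) row (widen_ord (geq_minl _ _) i) X^T)
      ->
  exists A : 'M[F]_(n + n),
    A^T *m sympJ F n *m A = sympJ F n /\ A *m X \is a mxOver S.
Proof.
move=> W WS; set k := minn _ _; set Y := \matrix_i _ => Yf.
have kn : (k <= n + n)%N by apply: geq_minr.
have rowY i : row i Y = row (widen_ord (geq_minl _ _) i) X^T by rewrite rowK.
have rowE p q r (M : 'M[F]_(p, n + n)) (N : 'M[F]_(q, n + n)) i j :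
    (M *m r *m N^T) i j = (row i M *m r *m (row j N)^T) 0 0.
  rewrite -row_mul [LHS]mxE [RHS]mxE; apply: eq_bigr => h _.
  by rewrite [row i _ _ _]mxE [(row j N)^T _ _]mxE [row j N _ _]mxE [N^T _ _]mxE.
have WE i j : W i j = (row i X^T *m sympJ F n *m (row j X^T)^T) 0 0.
  by rewrite -rowE trmxK.
have YS : gramr Y \is a mxOver S.
  apply/mxOverP => i j; rewrite rowE !rowY -WE WS //=.
  exact: leq_trans (ltn_ord i) kn.
have [B [Bu BS YB BY]] := extend_gram kn Yf YS.
have [Wt W0] := gram_alternating B^T; rewrite trmxK in Wt W0.
have [N NS NE] := alternating_gram (leqnn _) Wt W0 BS.
pose A := N *m invmx B^T; have BTu : B^T \in unitmx by rewrite unitmx_tr.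
have AB : A *m B^T = N by rewrite mulmxKV.
have Asym : A^T *m sympJ F n *m A = sympJ F n.
  have -> : A^T *m sympJ F n *m A =
      (invmx B^T)^T *m (N^T *m sympJ F n *m N) *m invmx B^T.
    by rewrite trmx_mul !mulmxA.
  by rewrite NE trmx_inv trmxK !mulmxA mulVmx // mul1mx -mulmxA mulmxV // mulmx1.
exists A; split=> //.
have NJu : N^T *m sympJ F n \in unitmx.
  have: N^T *m sympJ F n *m N \in unitmx.
    by rewrite NE !unitmx_mul Bu sympJ_unit BTu.
  by rewrite unitmx_mul => /andP[].
(* Since [N^T = B A^T] and [A] is symplectic, [N^T J A X = B J X]. *)
have -> : A *m X = invmx (N^T *m sympJ F n) *m (B *m sympJ F n *m X).
  apply: (canRL (mulKmx NJu)); rewrite -{1}AB trmx_mul trmxK.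
  by rewrite -[in RHS]Asym !mulmxA.
have BX : B *m sympJ F n *m X \is a mxOver S.
  apply/mxOverP => i j; rewrite -[X]trmxK rowE.
  (* A column of index below [k] is a row of [B], so its pairings are Gram entries of [B]. A later
     column forces [k = n + n]; then every row of [B] is one of the first [n + n] columns and the
     pairing is an entry of [W]. *)
  have [jk|kj] := ltnP j k.
    have -> : row j X^T = row (Ordinal jk) Y by rewrite rowY; congr row;
      apply: val_inj.
    have [i' ->] := YB (Ordinal jk).
    by rewrite -rowE (mxOverP BS).
  have kE : k = (n + n)%N.
    apply/eqP; rewrite eqn_leq kn /= leqNgt; apply: contraL kj => kn'.
    have [/minn_idPl km|nm] := leqP m (n + n).
      by rewrite -ltnNge /k km ltn_ord.
    by move: kn'; rewrite /k (minn_idPr (ltnW nm)) ltnn.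
  have [i' ->] := BY kE i; rewrite rowY -WE WS //=.
  exact: leq_trans (ltn_ord i') kn.
have SM p q r (M : 'M[F]_(p, q)) (M' : 'M[F]_(q, r)) :
    M \is a mxOver S -> M' \is a mxOver S -> M *m M' \is a mxOver S.
  move=> /mxOverP MS /mxOverP MS'; apply/mxOverP => i j.
  by rewrite mxE rpred_sum // => h _; rewrite rpredM.
have JS : sympJ F n \is a mxOver S.
  apply/mxOverP => i j; rewrite mxE; case: splitP => p _; rewrite mxE;
    by case: splitP => q _; rewrite !mxE ?rpredN ?rpred0 ?rpred_nat.
have NtS : N^T \is a mxOver S.
  by apply/mxOverP => i j; rewrite mxE (mxOverP NS).
exact: SM (mxOver_invmx (SM _ _ _ _ _ NtS JS)) BX.
Qed.
End SympJ.

(** * Evaluation of rational functions *)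

Lemma poly_nonroot (F : numDomainType) (p : {poly F}) :
  p != 0 -> exists x, p.[x] != 0.
Proof.
move=> p0; apply/not_existsP => px.
have := @max_poly_roots _ p [seq i%:R | i <- iota 0 (size p)] p0.
rewrite size_map size_iota ltnn => absurd; suff: false by [].
apply: absurd.
  by apply/allP => _ /mapP[i _ ->]; rewrite rootE; apply/negPn/negP/px.
rewrite map_inj_uniq ?iota_uniq // => i j /eqP.
by rewrite eqr_nat => /eqP.
Qed.

Lemma mpoly_nonroot (F : numDomainType) k (p : {mpoly F[k]}) :
  p != 0 -> exists v, p.@[v] != 0.
Proof.
elim: k p => [|k IH] p p0.
  exists (fun=> 0); move: p0; rewrite [p]nvar0_mpolyC mevalC.
  by apply: contra => /eqP ->; rewrite mpolyC0.
have q0 : lead_coef (muni p) != 0.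
  by rewrite lead_coef_eq0; apply: contra p0 => /eqP /muni_eq0 ->.
have [v qv] := IH _ q0.
have [|x px] := @poly_nonroot F (map_poly (meval v) (muni p)).
  by rewrite map_poly_eq0_id0 -?lead_coef_eq0.
pose v' i := if unlift ord_max i is Some j then v j else x.
exists v'; rewrite /meval (mmap_muni idfun v') {2}/v' unlift_none.
have -> // : map_poly (mmap idfun (v' \o widen_ord (leqnSn k))) (muni p) =
          map_poly (meval v) (muni p).
apply/polyP => i; rewrite !coef_map /=; apply: meval_eq => j /=.
rewrite /v' (_ : widen_ord _ j = lift ord_max j) ?liftK //.
by apply: val_inj; rewrite /= /bump leqNgt ltn_ord.
Qed.

Lemma tofrac_div_eq (P : idomainType) (p q p' q' : P) : q != 0 -> q' != 0 ->
  (p%:F / q%:F == p'%:F / q'%:F) = (p * q' == p' * q).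
Proof. by move=> q0 q'0; rewrite eqr_div ?tofrac_eq0 // -!tofracM tofrac_eq. Qed.

Section LocalEvaluation.
Variables (F : numFieldType) (k : nat).
Local Notation P := {mpoly F[k]}.
Local Notation K := {fraction {mpoly F[k]}}.
Implicit Types (v : 'I_k -> F) (x y : K) (r s : F).

(** A relation, because a fraction is defined at [v] as soon as one of its many representatives has
    a denominator that does not vanish there. *)
Definition evaluates v x r :=
  exists p q : P, [/\ q.@[v] != 0, x = p%:F / q%:F & r = p.@[v] / q.@[v]].

Lemma meval_neq0 v (q : P) : q.@[v] != 0 -> q != 0.
Proof. by apply: contraNneq => ->; rewrite meval0. Qed.

Lemma evaluates_inj v x r s : evaluates v x r -> evaluates v x s -> r = s.
Proof.
move=> [p [q [qv xE ->]]] [p' [q' [q'v xE' ->]]].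
have /eqP := etrans (esym xE) xE'.
rewrite tofrac_div_eq ?(meval_neq0 qv) ?(meval_neq0 q'v) // => /eqP e.
by apply/eqP; rewrite eqr_div // -!mevalM e.
Qed.

Lemma evaluates_tofrac v (p : P) : evaluates v p%:F p.@[v].
Proof. by exists p, 1; rewrite meval1 oner_neq0 tofrac1 !divr1. Qed.

Lemma evaluatesD v x y r s :
  evaluates v x r -> evaluates v y s -> evaluates v (x + y) (r + s).
Proof.
move=> [p [q [qv -> ->]]] [p' [q' [q'v -> ->]]].
exists (p * q' + p' * q), (q * q').
rewrite mevalM mulf_neq0 // addf_div ?tofrac_eq0 ?(meval_neq0 qv) ?(meval_neq0
  q'v) //.
by rewrite tofracD !tofracM [_ / _ + _ / _]addf_div // mevalD !mevalM.
Qed.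

Lemma evaluatesB v x y r s :
  evaluates v x r -> evaluates v y s -> evaluates v (x - y) (r - s).
Proof.
move=> xr [p [q [qv -> ->]]]; apply: evaluatesD => //.
by exists (- p), q; rewrite tofracN mevalN !mulNr.
Qed.

Lemma evaluatesM v x y r s :
  evaluates v x r -> evaluates v y s -> evaluates v (x * y) (r * s).
Proof.
move=> [p [q [qv -> ->]]] [p' [q' [q'v -> ->]]].
exists (p * p'), (q * q').
by rewrite mevalM mulf_neq0 // mulf_div !tofracM [_ / _ * (_ / _)]mulf_div
  !mevalM.
Qed.

Lemma evaluates_sum v (I : Type) (l : seq I) (f : I -> K) (g : I -> F) :
  (forall i, evaluates v (f i) (g i)) ->
  evaluates v (\sum_(i <- l) f i) (\sum_(i <- l) g i).
Proof.
move=> fg; elim/big_ind2: _ => //; last by move=> *; apply: evaluatesD.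
by rewrite -tofrac0 -[X in evaluates _ _ X](meval0 v); apply: evaluates_tofrac.
Qed.

Lemma evaluates1 v : evaluates v 1 1.
Proof. by rewrite -tofrac1 -[X in evaluates _ _ X](meval1 v);
  apply: evaluates_tofrac. Qed.

Lemma evaluates_const v c : evaluates v (const_frac F k c) c.
Proof. by rewrite -[X in evaluates _ _ X](mevalC v); apply: evaluates_tofrac. Qed.

Lemma evaluates_mmap v l (z : 'I_l -> K) (r : 'I_l -> F) (p : {mpoly F[l]}) :
  (forall i, evaluates v (z i) (r i)) ->
  evaluates v (mmap (const_frac F k) z p) p.@[r].
Proof.
move=> zr; rewrite /meval /mmap; apply: evaluates_sum => m.
apply: evaluatesM; first exact: evaluates_const.
rewrite /mmap1; elim/big_ind2: _ => [||i _]; first exact: evaluates1.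
  by move=> *; apply: evaluatesM.
elim: (m i) => [|j IH]; first by rewrite !expr0; apply: evaluates1.
by rewrite !exprS; apply: evaluatesM.
Qed.

(** If [x] were nonzero, some point would avoid the zeros of both [d] and its numerator, and the
    value of [x] there could not be 0. *)
Lemma evaluates_dense (d : P) x : d != 0 ->
  (forall v, d.@[v] != 0 -> evaluates v x 0) -> x = 0.
Proof.
move=> d0 xv; have := frac_repr x; set p := \n_(_); set q := \d_(_) => xE.
have q0 : q%:F != 0 :> K by rewrite tofrac_eq0 denom_ratioP.
suff /eqP p0 : p == 0 by rewrite xE p0 tofrac0 mul0r.
apply/negPn/negP => p0; have [v] := mpoly_nonroot (mulf_neq0 d0 p0).
rewrite mevalM mulf_eq0 negb_or => /andP[dv pv].
have [p' [q' [q'v]]] := xv v dv; rewrite xE => /eqP.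
rewrite tofrac_div_eq ?denom_ratioP ?(meval_neq0 q'v) // => /eqP e.
move=> /esym/eqP; rewrite mulf_eq0 invr_eq0 (negPf q'v) orbF => /eqP p'v.
by have /eqP := congr1 (meval v) e;
  rewrite !mevalM p'v mul0r mulf_eq0 (negPf pv) (negPf q'v).
Qed.

Lemma evaluates_near (I : finType) (z : I -> K) : exists2 d : P, d != 0 &
  forall v, d.@[v] != 0 -> exists r : I -> F, forall i, evaluates v (z i) (r i).
Proof.
exists (\prod_i \d_(repr (z i))).
  by apply/prodf_neq0 => i _; apply: denom_ratioP.
move=> v; rewrite rmorph_prod => /prodf_neq0 dv.
exists (fun i => (\n_(repr (z i))).@[v] / (\d_(repr (z i))).@[v]) => i.
by exists \n_(repr (z i)), \d_(repr (z i)); rewrite dv -?frac_repr.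
Qed.
End LocalEvaluation.

(** * Descent of invariants *)

Lemma map_sympJ (F F' : pzRingType) (f : {rmorphism F -> F'}) n :
  map_mx f (sympJ F n) = sympJ F' n.
Proof. by rewrite /sympJ map_block_mx map_mxN !map_mx0 !map_mx1. Qed.

Section Descent.
Variables (R : realType) (n m : nat).
Local Notation polyV := {mpoly R[(n + n) * m]}.
Local Notation ratV := {fraction {mpoly R[(n + n) * m]}}.
Local Notation iota := (const_frac R ((n + n) * m)).

Lemma symplecticV A : symplectic R n A -> symplectic R n (invmx A).
Proof.
move=> symA; have uA := symplectic_unit symA; rewrite /symplectic /=.
rewrite -[in LHS]symA !mulmxA -trmx_mul mulmxV // trmx1 mul1mx.
by rewrite -mulmxA mulmxV // mulmx1.
Qed.

Definition mxpoint (M : 'M[R]_(n + n, m)) : 'I_((n + n) * m) -> R :=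
  fun k => mxvec M 0 k.

Lemma mpeval_neq0 (p : polyV) : p != 0 -> exists M, mpeval p M != 0.
Proof.
move=> /mpoly_nonroot[v pv]; exists (vec_mx (\row_k v k)).
by rewrite /mpeval vec_mxK (meval_eq (v2 := v)) // => k; rewrite mxE.
Qed.

Lemma evaluates_mxdense (d : polyV) (x : ratV) : d != 0 ->
  (forall M, mpeval d M != 0 -> evaluates (mxpoint M) x 0) -> x = 0.
Proof.
move=> d0 xM; apply: evaluates_dense d0 _ => v dv.
have <- : mxpoint (vec_mx (\row_k v k)) = v.
  by apply/funext => k; rewrite /mxpoint vec_mxK mxE.
apply: xM; rewrite /mpeval vec_mxK (meval_eq (v2 := v)) // => k.
by rewrite mxE.
Qed.

Definition evaluates_mx M p q (Z : 'M[ratV]_(p, q)) (Z' : 'M[R]_(p, q)) :=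
  forall i j, evaluates (mxpoint M) (Z i j) (Z' i j).

Lemma evaluates_mxM M p q r (Y : 'M_(p, q)) (Z : 'M_(q, r)) Y' Z' :
  evaluates_mx M Y Y' -> evaluates_mx M Z Z' ->
  evaluates_mx M (Y *m Z) (Y' *m Z').
Proof.
move=> YY ZZ i j; rewrite !mxE; apply: evaluates_sum => h.
exact: evaluatesM.
Qed.

Lemma evaluates_mxT M p q (Y : 'M_(p, q)) Y' :
  evaluates_mx M Y Y' -> evaluates_mx M Y^T Y'^T.
Proof. by move=> YY i j; rewrite !mxE. Qed.

Lemma evaluates_mxC M p q (Y : 'M[R]_(p, q)) :
  evaluates_mx M (map_mx iota Y) Y.
Proof. by move=> i j; rewrite mxE; apply: evaluates_const. Qed.

Definition ratX : 'M[ratV]_(n + n, m) :=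
  map_mx (@FracField.tofrac polyV) (generic_point R n m).

Lemma evaluates_ratX M : evaluates_mx M ratX M.
Proof.
by move=> i j; rewrite mxE -[X in evaluates _ _ X](mpeval_generic i j M);
  apply: evaluates_tofrac.
Qed.

Definition mxsubst (Z : 'M[ratV]_(n + n, m)) (p : polyV) : ratV :=
  mmap iota (fun k => mxvec Z 0 k) p.

Lemma evaluates_mxsubst M Z Z' p :
  evaluates_mx M Z Z' -> evaluates (mxpoint M) (mxsubst Z p) (mpeval p Z').
Proof.
move=> ZZ; apply: evaluates_mmap => k.
by case/mxvec_indexP: k => i j; rewrite !mxvecE.
Qed.

Lemma mxsubst_mxOver (S : divringClosed ratV) Z p :
  (forall c, iota c \in S) -> Z \is a mxOver S -> mxsubst Z p \in S.
Proof.
move=> cS /mxOverP ZS; apply: mmap_divring => // k.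
by case/mxvec_indexP: k => i j; rewrite mxvecE.
Qed.

Lemma evaluates_mx_near (A : 'M[ratV]_(n + n)) : exists2 d : polyV, d != 0 &
  forall M, mpeval d M != 0 -> exists A', evaluates_mx M A A'.
Proof.
have [d d0 dA] := evaluates_near (fun ij : 'I_(n + n) * 'I_(n + n) => A ij.1
  ij.2).
exists d => // M /dA[r rA]; exists (\matrix_(i, j) r (i, j)) => i j.
by rewrite mxE; apply: rA (i, j).
Qed.

Lemma evaluates_symplectic M (A : 'M[ratV]_(n + n)) A' :
  A^T *m sympJ _ n *m A = sympJ _ n -> evaluates_mx M A A' -> symplectic R n A'.
Proof.
move=> symA AA; apply/matrixP => i j.
have := evaluates_mxM (evaluates_mxM (evaluates_mxT AA)
  (evaluates_mxC M (sympJ R n))) AA i j.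
rewrite map_sympJ symA -(map_sympJ iota) => e.
exact: evaluates_inj e (evaluates_mxC _ _ _ _).
Qed.

Lemma sp_act_mpeval (p q : polyV) A M :
  (forall A, symplectic R n A -> sp_act A p * q = p * sp_act A q) ->
  symplectic R n A ->
  mpeval p (A *m M) * mpeval q M = mpeval p M * mpeval q (A *m M).
Proof.
move=> pq symA; have := congr1 (fun r => mpeval r M) (pq _ (symplecticV symA)).
rewrite /= /mpeval !mevalM -!/(mpeval _ _).
by rewrite !mpeval_sp_act invmxK.
Qed.

(* A is evaluated at real points, where it is a real symplectic matrix. *)
Lemma mxsubst_symplectic (p q : polyV) (A : 'M[ratV]_(n + n)) :
  (forall A, symplectic R n A -> sp_act A p * q = p * sp_act A q) ->
  A^T *m sympJ _ n *m A = sympJ _ n ->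
  mxsubst (A *m ratX) p * q%:F = p%:F * mxsubst (A *m ratX) q.
Proof.
move=> pq symA; have [d d0 dA] := evaluates_mx_near A.
apply/eqP; rewrite -subr_eq0; apply/eqP;
  apply: evaluates_mxdense d0 _ => M /dA[A' AA].
have -> : (0 : R) = mpeval p (A' *m M) * mpeval q M - mpeval p M * mpeval q (A'
  *m M).
  by rewrite (sp_act_mpeval _ pq) ?subrr //; apply: evaluates_symplectic AA.
have AX := evaluates_mxM AA (evaluates_ratX M).
apply: evaluatesB; apply: evaluatesM.
- exact: evaluates_mxsubst.
- exact: evaluates_tofrac.
- exact: evaluates_tofrac.
exact: evaluates_mxsubst.
Qed.

(** Choose [M] with [q] nonzero at [M] and [A] defined there with value [A']. For [A0] the inverse
    of [A'], the matrix [A0 A X] takes the value [M] at [M]. *)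
Lemma symplectic_translate (q : polyV) (A : 'M[ratV]_(n + n)) : q != 0 ->
    A^T *m sympJ _ n *m A = sympJ _ n -> exists2 A0, symplectic R n A0 &
  mxsubst (map_mx iota A0 *m A *m ratX) q != 0.
Proof.
move=> q0 symA; have [d d0 dA] := evaluates_mx_near A.
have [M] := mpeval_neq0 (mulf_neq0 d0 q0).
rewrite /mpeval mevalM mulf_eq0 negb_or => /andP[dM qM].
have [A' AA] := dA M dM; have symA' := evaluates_symplectic symA AA.
exists (invmx A'); first exact: symplecticV.
apply: contra qM => /eqP e.
have := evaluates_mxsubst q (evaluates_mxM (evaluates_mxM
  (evaluates_mxC M (invmx A')) AA) (evaluates_ratX M)).
rewrite e mulVmx ?symplectic_unit // mul1mx => qM.
by rewrite -[meval _ _](evaluates_inj (evaluates_tofrac (mxpoint M) 0)) ?meval0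
  // tofrac0.
Qed.

(** The minor on the first [minn m (n + n)] rows and columns of the generic matrix is nonzero: it
    equals 1 at the matrix with ones on the main diagonal and zeros elsewhere. *)
Lemma ratX_row_free : row_free
  (\matrix_(i < minn m (n + n)) row (widen_ord (geq_minl _ _) i) ratX^T).
Proof.
set Y := \matrix_i _; pose wm i : 'I_m := widen_ord (geq_minl m (n + n)) i.
pose wn i : 'I_(n + n) := widen_ord (geq_minr m (n + n)) i.
pose C : 'M[ratV]_(n + n, minn m (n + n)) := \matrix_(i, j) (i == wn j)%:R.
pose G : 'M[polyV]_(minn m (n + n)) := \matrix_(i, j) generic_point R n m (wn j)
  (wm i).
have YC : Y *m C = map_mx (@FracField.tofrac polyV) G.
  apply/matrixP => i j; rewrite !mxE (bigD1 (wn j)) //= big1 ?addr0.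
    by rewrite !mxE eqxx mulr1.
  by move=> h /negPf hj; rewrite !mxE hj mulr0.
have G0 : \det G != 0.
  pose M : 'M[R]_(n + n, m) := \matrix_(i, j) (i == j :> nat)%:R.
  have : mpeval (\det G) M = 1.
    rewrite /mpeval -det_map_mx -[RHS](det1 _ (minn m (n + n)));
      congr determinant.
    apply/matrixP => i j; rewrite [LHS]mxE [G i j]mxE.
    rewrite -[LHS]/(mpeval (generic_point R n m (wn j) (wm i)) M) mpeval_generic.
    by rewrite !mxE /= eq_sym val_eqE.
  by apply: contra_eqN => /eqP ->; rewrite /mpeval meval0 eq_sym oner_eq0.
have YCu : Y *m C \in unitmx by rewrite YC unitmxE det_map_mx unitfE tofrac_eq0.
by apply/row_freeP; exists (C *m invmx (Y *m C)); rewrite mulmxA mulmxV.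
Qed.

Definition omega (i j : 'I_m) : polyV :=
  ((generic_point R n m)^T *m sympJ _ n *m generic_point R n m) i j.

(* Moving the generic point by a symplectic matrix over the function field puts
   it over the field generated by the forms omega. *)
Lemma invariant_descent (S : divringClosed ratV) (p q : polyV) :
    (forall c, iota c \in S) ->
    (forall i j : 'I_m, (i < n + n)%N -> (omega i j)%:F \in S) -> q != 0 ->
    (forall A, symplectic R n A -> sp_act A p * q = p * sp_act A q) ->
  p%:F / q%:F \in S.
Proof.
move=> cS omS q0 pq.
have [|A [symA AS]] := symplectic_descent (S := S) (X := ratX) _ ratX_row_free.
  move=> i j i_lt; rewrite /ratX matrix.map_trmx -(map_sympJ (@FracField.tofrac
    polyV)) -!map_mxM.
  by rewrite mxE; apply: omS.
have [A0 symA0 qA] := symplectic_translate q0 symA.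
set A1 := map_mx iota A0 *m A in qA.
have symA1 : A1^T *m sympJ _ n *m A1 = sympJ _ n.
  have -> : A1^T *m sympJ _ n *m A1 =
      A^T *m map_mx iota (A0^T *m sympJ R n *m A0) *m A.
    by rewrite !map_mxM map_sympJ -matrix.map_trmx /A1 trmx_mul !mulmxA.
  by rewrite (symA0 : _ = sympJ R n) map_sympJ.
have AS1 : A1 *m ratX \is a mxOver S.
  rewrite /A1 -mulmxA; apply/mxOverP => i j; rewrite mxE rpred_sum // => h _.
  by rewrite rpredM ?(mxOverP AS) // mxE.
(* By invariance the fraction keeps its value at [A1 X], whose entries lie in [S]. *)
have -> : p%:F / q%:F = mxsubst (A1 *m ratX) p / mxsubst (A1 *m ratX) q.
  apply/eqP; rewrite eqr_div ?tofrac_eq0 //.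
  by rewrite (mxsubst_symplectic pq symA1).
by rewrite rpred_div ?mxsubst_mxOver.
Qed.
End Descent.

(** * Counting the independent forms *)

Section Pairs.
Variables (n m : nat).

(** Index set of the transcendence basis of the rational invariants; forms with both indices at
    least [n + n] are rational in those kept. *)
Definition pairs : {set 'I_m * 'I_m} :=
  [set ij : 'I_m * 'I_m | (ij.1 < ij.2)%N && (ij.1 < n + n)%N]%SET.

Lemma card_pairs : #|pairs| = (\sum_(i < m | (i < n + n)%N) (m - i.+1))%N.
Proof.
rewrite -sum1_card (eq_bigl (fun p : 'I_m * 'I_m => (p.1 < n + n) && (p.1 <
  p.2))%N); last first.
  by move=> p; rewrite inE andbC.
rewrite -(pair_big_dep (fun i : 'I_m => (i < n + n)%N) (fun i j : 'I_m => (i <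
  j)%N)
  (fun _ _ => 1%N)) /=.
apply: eq_bigr => i _; rewrite -(big_mkord (fun j => i < j)%N (fun=> 1%N)).
by rewrite -(big_nat_widenl i.+1 0 m xpredT) // sum_nat_const_nat muln1.
Qed.

(** The binomial stands on the left to avoid a truncated difference. *)
Lemma sum_subS_bin k l : (k <= l)%N ->
  (\sum_(i < k) (l - i.+1) + 'C(k.+1, 2) = l * k)%N.
Proof.
elim: k => [|k IH] kl; first by rewrite big_ord0 bin_small // muln0.
rewrite big_ord_recr /= binS bin1 addnACA IH 1?ltnW // subnK // mulnS.
by rewrite addnC.
Qed.

Lemma card_pairs_le : (m <= n + n)%N -> #|pairs| = 'C(m, 2).
Proof.
move=> mn; rewrite card_pairs (eq_bigl xpredT) => [|i];
  last by rewrite (leq_trans (ltn_ord i)).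
have := sum_subS_bin (leqnn m); have := mul_bin_diag m 1; rewrite binS !bin1.
set b := 'C(m, 2); set c := (\sum_(i < m) _)%N => e1 e2.
suff : (m * m.-1 + m = m * m)%N by lia.
by case: (m) => // k /=; rewrite mulnS addnC.
Qed.

Lemma card_pairs_ge : (n + n <= m)%N -> #|pairs| = (2 * n * m - n * (2 * n +
  1))%N.
Proof.
move=> nm; rewrite card_pairs -(big_mkord (fun i => i < n + n)%N (fun i => m -
  i.+1)%N).
rewrite -(big_nat_widen 0 (n + n) m xpredT) // big_mkord.
have := sum_subS_bin nm; have := mul_bin_diag (n + n).+1 1; rewrite bin1 /=.
by set b := 'C(_, 2); set c := (\sum_(i < _) _)%N; nia.
Qed.
End Pairs.

(** * Generators of the invariant field, and averaging *)

Section Invariants.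
Variables (R : realType) (n m : nat).
Local Notation polyV := {mpoly R[(n + n) * m]}.
Local Notation ratV := {fraction {mpoly R[(n + n) * m]}}.
Local Notation iota := (const_frac R ((n + n) * m)).
Local Notation omega := (@omega R n m).
Local Notation X := (generic_point R n m).

(** The map [pullback] with its morphism structure, so that sums, products and matrices pass through
    it. *)
Definition pullback_rmorph (Y : 'M[polyV]_(n + n, m)) : {rmorphism polyV ->
  polyV} :=
  comp_mpoly [tuple mxvec Y 0 k | k < (n + n) * m].

Lemma pullback_omega Y i j :
  pullback Y (omega i j) = (Y^T *m sympJ _ n *m Y) i j.
Proof.
have YE : map_mx (pullback_rmorph Y) X = Y.
  by apply/matrixP => h l; rewrite mxE; apply: pullback_generic.
rewrite -[LHS]/(pullback_rmorph Y (omega i j)) -[X in _ = (X^T *m _ *m X) _ _]YE.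
by rewrite matrix.map_trmx -(map_sympJ (pullback_rmorph Y)) -!map_mxM [RHS]mxE.
Qed.

Lemma sp_act_omega A i j : symplectic R n A -> sp_act A (omega i j) = omega i j.
Proof.
move=> symA; rewrite /sp_act pullback_omega; set B := invmx A.
have symB : symplectic R n B by apply: symplecticV.
have -> : forall Y : 'M[polyV]_(n + n, m), (map_mx (@mpolyC _ R) B *m Y)^T *m
    sympJ _ n *m (map_mx (@mpolyC _ R) B *m Y) =
    Y^T *m map_mx (@mpolyC _ R) (B^T *m sympJ R n *m B) *m Y.
  by move=> Y; rewrite !map_mxM map_sympJ -matrix.map_trmx trmx_mul !mulmxA.
by rewrite (symB : _ = sympJ R n) map_sympJ.
Qed.

Lemma sym_act_omega s i j : sym_act s (omega i j) = omega (s i) (s j).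
Proof.
rewrite /sym_act pullback_omega /omega mxE [RHS]mxE; apply: eq_bigr => h _.
rewrite mxE [in RHS]mxE; congr (_ * _); last by rewrite mxE.
by apply: eq_bigr => l _; congr (_ * _); rewrite !mxE.
Qed.

Let tofrac_omegaE i j :
  (omega i j)%:F = ((ratX R n m)^T *m sympJ _ n *m ratX R n m) i j.
Proof.
rewrite /ratX matrix.map_trmx -(map_sympJ (@FracField.tofrac polyV)) -!map_mxM.
by rewrite [RHS]mxE.
Qed.

Lemma omegaN i j : (omega j i)%:F = - (omega i j)%:F.
Proof.
have [/matrixP/(_ i j) Wt _] := gram_alternating (ratX R n m).
by rewrite !tofrac_omegaE; move: Wt; rewrite mxE => ->; rewrite mxE.
Qed.

Lemma omega_diag i : (omega i i)%:F = 0.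
Proof. by rewrite tofrac_omegaE; case: (gram_alternating (ratX R n m)). Qed.

Lemma mpeval_omega i j M : mpeval (omega i j) M = (M^T *m sympJ R n *m M) i j.
Proof.
rewrite /mpeval /omega.
have XE : map_mx (meval (mxpoint M)) X = M.
  by apply/matrixP => h l; rewrite mxE; apply: mpeval_generic.
rewrite -[X in _ = (X^T *m _ *m X) _ _]XE.
by rewrite matrix.map_trmx -(map_sympJ (meval (mxpoint M))) -!map_mxM [RHS]mxE.
Qed.

Local Notation d := #|pairs n m|.

Definition pair_omega (k : 'I_d) : polyV := omega (enum_val k).1 (enum_val k).2.

Lemma sp_act_mmap l (t : 'I_l -> polyV) p A :
  (forall k, sp_act A (t k) = t k) ->
  sp_act A (mmap (@mpolyC _ R) t p) = mmap (@mpolyC _ R) t p.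
Proof.
move=> At; pose f : {rmorphism {mpoly R[l]} -> polyV} :=
  pullback_rmorph (map_mx (@mpolyC _ R) (invmx A) *m X) \o mmap (@mpolyC _ R) t.
rewrite -[LHS]/(f p);
  apply: (mpoly_rmorph_eq (g := mmap (@mpolyC _ R) t)) => [c|k].
  by rewrite /f /= mmapC /pullback_rmorph /= comp_mpolyC.
by rewrite /f /= mmapX mmap1U; apply: At.
Qed.

Lemma mmap_tofrac l (t : 'I_l -> polyV) p :
  mmap iota (fun k => (t k)%:F) p = (mmap (@mpolyC _ R) t p)%:F.
Proof.
apply: (mpoly_rmorph_eq (f := mmap iota _)
  (g := (@FracField.tofrac polyV) \o mmap (@mpolyC _ R) t)) => [c|k] /=.
  by rewrite !mmapC.
by rewrite !mmapX !mmap1U.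
Qed.

Local Notation a := (fun k : 'I_d => (pair_omega k)%:F).

Lemma rat_invariants_genfield f :
  rat_invariants R n m f -> f \in genfield iota (range a).
Proof.
move=> finv; have fE := frac_repr f;
  move: (\n_(_)) (\d_(_)) (denom_ratioP (repr f)) fE.
move=> p q q0 fE; rewrite fE; apply: invariant_descent => // [c|i j i_lt|A symA].
- exact: genfield_const.
(* Only increasing pairs index generators; the other forms follow by antisymmetry, and the diagonal
   ones vanish. *)
- have aE (k l : 'I_m) : (k < l)%N -> (k < n + n)%N ->
      (omega k l)%:F \in genfield iota (range a).
    move=> kl kn; have klT : (k, l) \in pairs n m by rewrite inE kl kn.
    apply: mem_genfield; exists (enum_rank_in klT (k, l)) => //.
    by rewrite /pair_omega enum_rankK_in.
  have [ij|ji|/val_inj ij] := ltngtP i j; first exact: aE.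
    by rewrite omegaN rpredN aE // (ltn_trans ji).
  by rewrite ij omega_diag rpred0.
have := finv A symA; rewrite fE sp_actFE // => /eqP.
rewrite tofrac_div_eq => [/eqP//||//].
by rewrite -(inj_eq (can_inj (sp_actK (symplectic_unit symA)))) in q0; move: q0;
  rewrite /sp_act /pullback raddf0.
Qed.

(** The generators [pair_omega] are themselves invariant polynomials, so a quotient of polynomials
    in them is a quotient of invariants. *)
Lemma rat_invariants_frac f : rat_invariants R n m f ->
  exists p q, [/\ poly_invariants R n m p, poly_invariants R n m q, q != 0 & f =
    p%:F / q%:F].
Proof.
move=> /rat_invariants_genfield/genfield_range[p [q]].
rewrite !mmap_tofrac tofrac_eq0 => -[q0 ->].
exists (mmap (@mpolyC _ R) pair_omega p), (mmap (@mpolyC _ R) pair_omega q).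
by split=> // A symA; apply: sp_act_mmap => k; apply: sp_act_omega.
Qed.

Lemma sp_sym_actC A s p : sp_act A (sym_act s p) = sym_act s (sp_act A p) :>
  polyV.
Proof.
rewrite /sp_act /sym_act [LHS]pullback_comp [RHS]pullback_comp.
apply: (congr1 (fun Y => pullback Y p)); apply/matrixP => i j.
rewrite [LHS]mxE [RHS]mxE [col_perm s X i j]mxE pullback_generic.
rewrite -[RHS]/(pullback_rmorph (col_perm s X) _) [LHS]mxE.
rewrite [X in pullback_rmorph _ X]mxE rmorph_sum; apply: eq_bigr => h _.
rewrite [RHS]rmorphM -[X in _ = _ * X]/(pullback (col_perm s X) (X h j)).
rewrite pullback_generic [col_perm s X h j]mxE; congr (_ * _).
by rewrite mxE /pullback_rmorph /= comp_mpolyC.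
Qed.

Lemma sym_act1 s : sym_act s 1 = 1 :> polyV.
Proof. exact: (rmorph1 (pullback_rmorph (col_perm s X))). Qed.

Lemma sym_act_prod s (I : finType) (P : pred I) (f : I -> polyV) :
  sym_act s (\prod_(i | P i) f i) = \prod_(i | P i) sym_act s (f i).
Proof. exact: (rmorph_prod (pullback_rmorph (col_perm s X))). Qed.

(** The order of the factors reflects the convention that [(t * s)%g] applies [t] first. *)
Lemma sym_actA s t (p : polyV) : sym_act s (sym_act t p) = sym_act (t * s)%g p.
Proof.
rewrite /sym_act pullback_comp; congr pullback; apply/matrixP => i j.
by rewrite mxE [X in pullback _ X]mxE pullback_generic !mxE permM.
Qed.

Lemma sym_act_neq0 s (p : polyV) : (sym_act s p != 0) = (p != 0).
Proof.
have s0 : sym_act s 0 = 0 :> polyV by apply: (raddf0 (pullback_rmorph (col_perm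
  s X))).
by rewrite -{1}s0 (inj_eq (can_inj (sym_actK s))).
Qed.

Lemma pullback_scale_sum Y c (I : finType) (f : I -> polyV) :
  pullback Y (c *: \sum_i f i) = c *: \sum_i pullback Y (f i).
Proof.
rewrite {1}/pullback comp_mpolyZ; congr (_ *: _).
exact: (rmorph_sum (pullback_rmorph Y)).
Qed.

Lemma fact_unit (F : numFieldType) : (m`!%:R : F) != 0.
Proof. by rewrite pnatr_eq0 -lt0n fact_gt0. Qed.

Lemma average_fixed (p : polyV) : (forall s, sym_act s p = p) -> average p = p.
Proof.
move=> sp; rewrite /average (eq_bigr (fun=> p)) // sumr_const -scaler_nat.
by rewrite card_Sn scalerA mulVf ?fact_unit // scale1r.
Qed.

Lemma sym_act_average s (p : polyV) : sym_act s (average p) = average p.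
Proof.
rewrite /average {1}/sym_act pullback_scale_sum.
congr (_ *: _); rewrite (reindex_inj (mulIg s^-1%g)) /=; apply: eq_bigr => t _.
by rewrite -[LHS]/(sym_act s _) sym_actA mulgKV.
Qed.

Lemma poly_invariants_average p : poly_invariants R n m p -> poly_invariants R n
  m (average p).
Proof.
move=> pinv A symA; rewrite /average /sp_act pullback_scale_sum.
congr (_ *: _); apply: eq_bigr => s _.
by rewrite -[LHS]/(sp_act A _) sp_sym_actC pinv.
Qed.

(** Averaging preserves symplectic invariance because the two actions commute, and it is a
    projection onto the symmetric elements. *)
Lemma sym_poly_invariantsP p : sym_poly_invariants R n m p <->
  poly_invariants R n m p /\ forall s, sym_act s p = p.
Proof.
split=> [[q qinv <-]|[pinv sp]]; last by exists p => //; apply: average_fixed.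
by split=> [|s]; [apply: poly_invariants_average|apply: sym_act_average].
Qed.
End Invariants.

(** * Realizing prescribed values of the forms *)

Section Skew.
Variables (n m : nat).
Local Notation d := #|pairs n m|.

Definition pair_value (V : zmodType) (c : 'I_d -> V) ij :=
  if [pick k | enum_val k == ij] is Some k then c k else 0.

Lemma pair_value_enum (V : zmodType) (c : 'I_d -> V) k :
  pair_value c (enum_val k) = c k.
Proof.
rewrite /pair_value; case: pickP => [l /eqP/enum_val_inj -> //|/(_ k)].
by rewrite eqxx.
Qed.

Lemma pair_value_out (V : zmodType) (c : 'I_d -> V) ij :
  ij \notin pairs n m -> pair_value c ij = 0.
Proof.
rewrite /pair_value; case: pickP => // k /eqP <-.
by rewrite enum_valP.
Qed.

(** The alternating matrix with prescribed entries on [pairs]; where both indices are at least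
    [n + n] the entry defaults to 0. *)
Definition skew (V : zmodType) (c : 'I_d -> V) : 'M[V]_m :=
  \matrix_(i, j) (pair_value c (i, j) - pair_value c (j, i)).

Lemma skew_enum (V : zmodType) (c : 'I_d -> V) k :
  skew c (enum_val k).1 (enum_val k).2 = c k.
Proof.
have := enum_valP k; rewrite inE => /andP[lt12 _].
rewrite mxE -surjective_pairing pair_value_enum pair_value_out ?subr0 //.
by rewrite inE /= ltnNge ltnW.
Qed.

Lemma map_skew (V W : zmodType) (f : {additive V -> W}) c :
  map_mx f (skew c) = skew (f \o c).
Proof.
by apply/matrixP => i j; rewrite !mxE raddfB /pair_value; congr (_ - _);
  case: pickP => //=; rewrite raddf0.
Qed.

Lemma skewE (V : zmodType) (W : 'M[V]_m) (i j : 'I_m) :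
    W^T = - W -> (forall i, W i i = 0) -> (i < n + n)%N ->
  skew (fun k : 'I_d => W (enum_val k).1 (enum_val k).2) i j = W i j.
Proof.
move=> Wt W0 i_lt; set c := fun _ => _.
have pvE (k l : 'I_m) : (k < l)%N -> (k < n + n)%N -> pair_value c (k, l) = W k l.
  move=> kl kn; have klT : (k, l) \in pairs n m by rewrite inE kl kn.
  by rewrite -(enum_rankK_in klT klT) pair_value_enum /c enum_rankK_in.
have pv0 (k l : 'I_m) : (l <= k)%N -> pair_value c (k, l) = 0.
  by move=> lk; rewrite pair_value_out // inE /= ltnNge lk.
rewrite mxE; have [ij|ji|/val_inj ->] := ltngtP i j.
- by rewrite pvE // pv0 ?subr0 // ltnW.
- rewrite pv0 1?ltnW // pvE // ?(ltn_trans ji) // sub0r.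
  by move/matrixP/(_ i j): Wt; rewrite !mxE => ->; rewrite opprK.
by rewrite subrr W0.
Qed.

Lemma skew_alternating (V : zmodType) (c : 'I_d -> V) :
  (skew c)^T = - skew c /\ forall i, skew c i i = 0.
Proof. by split=> [|i]; [apply/matrixP => i j;
  rewrite !mxE opprB|rewrite mxE subrr]. Qed.

Lemma gram_exists (F : fieldType) k (W : 'M[F]_k) : (k <= n + n)%N ->
    W^T = - W -> (forall i, W i i = 0) ->
  exists N : 'M[F]_(n + n, k), N^T *m sympJ F n *m N = W.
Proof.
move=> kn Wt W0.
(* Here [frac_image idfun] is the whole field, seen as a closed predicate. *)
have [|N _ NE] := @alternating_gram F (frac_image idfun) k n W kn Wt W0;
  last by exists N.
by apply/mxOverP => i j; apply: (frac_image_id idfun).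
Qed.

Lemma skew_realize_le (F : fieldType) (c : 'I_d -> F) : (m <= n + n)%N ->
  exists M : 'M[F]_(n + n, m), forall k,
    (M^T *m sympJ F n *m M) (enum_val k).1 (enum_val k).2 = c k.
Proof.
have [Wt W0] := skew_alternating c => mn.
by have [M ME] := gram_exists mn Wt W0; exists M => k; rewrite ME skew_enum.
Qed.

(** Realize the invertible corner block by a square [N], then solve [N^T J M] = (first rows of [W])
    for [M]. The first columns of [M] are [N], so the Gram matrix of [M] has the prescribed first
    rows. *)
Lemma skew_realize_ge (F : fieldType) (c : 'I_d -> F) (nm : (n + n <= m)%N) :
    mxsub (widen_ord nm) (widen_ord nm) (skew c) \in unitmx ->
  exists M : 'M[F]_(n + n, m), forall k,
    (M^T *m sympJ F n *m M) (enum_val k).1 (enum_val k).2 = c k.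
Proof.
set W := skew c; set w := widen_ord nm; set W1 := mxsub w w W => W1u.
have [Wt W0] := skew_alternating c.
have [||N NE] := @gram_exists F _ W1 (leqnn _).
- by apply/matrixP => i j; move/matrixP/(_ (w i) (w j)): Wt; rewrite !mxE.
- by move=> i; rewrite mxE W0.
have NJu : N^T *m sympJ F n \in unitmx.
  by move: W1u; rewrite -NE unitmx_mul => /andP[].
pose M := invmx (N^T *m sympJ F n) *m rowsub w W.
have MN : colsub w M = N.
  rewrite /M -mulmx_colsub [X in _ *m X](_ : _ = W1) -?NE ?mulKmx //.
  by rewrite NE; apply/matrixP => i j; rewrite !mxE.
have MW : rowsub w (M^T *m sympJ F n *m M) = rowsub w W.
  rewrite -!mul_rowsub_mx [rowsub w M^T](_ : _ = N^T) ?mulKVmx //.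
  by rewrite -MN; apply/matrixP => i j; rewrite !mxE.
exists M => k; rewrite -skew_enum -/W.
have := enum_valP k; rewrite inE => /andP[_ i_lt].
have /matrixP/(_ (Ordinal i_lt) (enum_val k).2) := MW; rewrite !mxE.
by rewrite (_ : w _ = (enum_val k).1) //; apply: val_inj.
Qed.
End Skew.

(** * Algebraic independence of the forms *)

Section MainProof.
Variables (R : realType) (n m : nat).
Local Notation polyV := {mpoly R[(n + n) * m]}.
Local Notation ratV := {fraction {mpoly R[(n + n) * m]}}.
Local Notation iota := (const_frac R ((n + n) * m)).
Local Notation d := #|pairs n m|.
Local Notation pair_omega := (@pair_omega R n m).

Lemma mpeval_mmap l (t : 'I_l -> polyV) p M :
  mpeval (mmap (@mpolyC _ R) t p) M = p.@[fun k => mpeval (t k) M].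
Proof.
pose f : {rmorphism {mpoly R[l]} -> R} := meval (mxpoint M) \o mmap (@mpolyC _
  R) t.
rewrite -[LHS]/(f p); apply: (mpoly_rmorph_eq (g := meval _)) => [c|k].
  by rewrite /f /= mmapC !mevalC.
by rewrite /f /= mmapX mmap1U mevalXU.
Qed.

(** Specialize the variables to the forms of a matrix [M] whose first [n + n] columns are the
    standard basis: the block becomes [J]. *)
Lemma skewX_nonsingular (nm : (n + n <= m)%N) :
  \det (mxsub (widen_ord nm) (widen_ord nm) (skew (fun k : 'I_d => 'X_k : {mpoly
    R[d]}))) != 0.
Proof.
pose M : 'M[R]_(n + n, m) := \matrix_(i, j) (i == j :> nat)%:R.
pose W := M^T *m sympJ R n *m M.
pose c (k : 'I_d) := W (enum_val k).1 (enum_val k).2.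
have [Wt W0] := gram_alternating M.
suff : (\det (mxsub (widen_ord nm) (widen_ord nm)
    (skew (fun k : 'I_d => 'X_k : {mpoly R[d]})))).@[c] != 0.
  by apply: contraNneq => ->; rewrite meval0.
rewrite -det_map_mx map_mxsub map_skew.
have -> : skew (meval c \o (fun k : 'I_d => 'X_k)) = skew c.
  by congr skew; apply/funext => k /=; rewrite mevalXU.
have -> : mxsub (widen_ord nm) (widen_ord nm) (skew c) = sympJ R n.
  have MI : colsub (widen_ord nm) M = 1%:M by apply/matrixP => i j; rewrite !mxE.
  have -> : mxsub (widen_ord nm) (widen_ord nm) (skew c) =
      (colsub (widen_ord nm) M)^T *m sympJ R n *m colsub (widen_ord nm) M.
    apply/matrixP => i j; rewrite mxE skewE //; last exact: (ltn_ord i).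
    have -> : (colsub (widen_ord nm) M)^T = rowsub (widen_ord nm) M^T.
      by apply/matrixP => h l; rewrite !mxE.
    by rewrite mulmx_colsub [RHS]mxE -!mulmxA mul_rowsub_mx [RHS]mxE mulmxA.
  by rewrite MI trmx1 mul1mx mulmx1.
by rewrite -unitfE -unitmxE sympJ_unit.
Qed.

(** A relation vanishes at every family of values of the forms on real matrices. These families are
    all of the space if [m <= n + n], and otherwise include every point where the corner determinant
    is nonzero. *)
Lemma alg_independent_pair_omega :
  alg_independent iota (fun k => (pair_omega k)%:F).
Proof.
move=> p; rewrite mmap_tofrac => /eqP; rewrite tofrac_eq0 => /eqP p0.
have pM M : p.@[fun k => (M^T *m sympJ R n *m M) (enum_val k).1 (enum_val k).2]
  = 0.
  have := mpeval_mmap pair_omega p M; rewrite p0 /mpeval meval0 => ->.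
  by apply: meval_eq => k; rewrite -[RHS]/(mpeval _ _) mpeval_omega.
have pc (c : 'I_d -> R) : (exists M : 'M[R]_(n + n, m), forall k,
    (M^T *m sympJ R n *m M) (enum_val k).1 (enum_val k).2 = c k) -> p.@[c] = 0.
  by case=> M Mc; rewrite -(pM M); apply: meval_eq => k; rewrite Mc.
apply/eqP/negPn/negP => pn0.
have [mn|/ltnW nm] := leqP m (n + n).
  have [c /negP] := mpoly_nonroot pn0; apply; apply/eqP/pc.
  exact: skew_realize_le.
have [c] := mpoly_nonroot (mulf_neq0 pn0 (skewX_nonsingular nm)).
rewrite mevalM mulf_eq0 negb_or => /andP[/negP pc0 Dc]; apply: pc0; apply/eqP/pc.
apply: (skew_realize_ge (nm := nm)).
rewrite unitmxE unitfE; apply: contraNneq Dc => Dc.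
rewrite -det_map_mx map_mxsub map_skew -[X in _ == X]Dc.
apply/eqP; congr (\det (mxsub _ _ (skew _))); apply/funext => k /=.
by rewrite mevalXU.
Qed.
End MainProof.

(** * Symmetric invariants and their transcendence degree *)

Section MainProof.
Variables (R : realType) (n m : nat).
Local Notation polyV := {mpoly R[(n + n) * m]}.
Local Notation ratV := {fraction {mpoly R[(n + n) * m]}}.
Local Notation iota := (const_frac R ((n + n) * m)).
Local Notation d := #|pairs n m|.
Local Notation pair_omega := (@pair_omega R n m).
Local Notation sp_rm A := (pullback_rmorph
  (map_mx (@mpolyC _ R) (invmx A) *m generic_point R n m)).

Lemma sp_actM A (p q : polyV) : sp_act A (p * q) = sp_act A p * sp_act A q.
Proof. exact: (rmorphM (sp_rm A)). Qed.

Lemma sp_act_prod A (I : finType) (P : pred I) (f : I -> polyV) :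
  sp_act A (\prod_(i | P i) f i) = \prod_(i | P i) sp_act A (f i).
Proof. exact: (rmorph_prod (sp_rm A)). Qed.

Lemma averageFE (p q : polyV) : q != 0 -> (forall s, sym_act s q = q) ->
  averageF (p%:F / q%:F) = (average p)%:F / q%:F :> ratV.
Proof.
move=> q0 sq; rewrite /averageF (eq_bigr (fun s => (sym_act s p)%:F / q%:F)) =>
  [|s _].
  rewrite -mulr_suml mulrA /average -mul_mpolyC tofracM; congr (_ * _ / _).
    by rewrite -[RHS]/(iota _) fmorphV rmorph_nat.
  by rewrite (rmorph_sum (@FracField.tofrac polyV)).
by rewrite sym_actFE // sq.
Qed.

Lemma sym_rat_invariantsE :
  sym_rat_invariants R n m = fraction_field (sym_poly_invariants R n m).
Proof.
apply/seteqP; split=> [_ [f /rat_invariants_frac[p [q [pinv qinv q0 fE]]] <-]|x].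
  (* [Q] is the product of the conjugates of [q]. Expanding the fraction by the cofactor [Q'] makes
     its denominator symmetric, so averaging affects only the numerator. *)
  pose Q : polyV := \prod_(s : 'S_m) sym_act s q.
  pose Q' : polyV := \prod_(s : 'S_m | s != 1%g) sym_act s q.
  have QE : Q = q * Q'.
    rewrite /Q (bigD1 1%g) //=; congr (_ * _).
    by rewrite -[RHS](sym_actK 1%g) sym_actA mulgV.
  have Q0 : Q != 0 by apply/prodf_neq0 => s _; rewrite sym_act_neq0.
  have Q'0 : Q' != 0 by apply/prodf_neq0 => s _; rewrite sym_act_neq0.
  have sQ s : sym_act s Q = Q.
    rewrite sym_act_prod [RHS](reindex_inj (mulIg s)); apply: eq_bigr => t _.
    by rewrite sym_actA.
  have inv_prod (P : pred 'S_m) : poly_invariants R n m (\prod_(s | P s) sym_act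
    s q).
    move=> A symA; rewrite sp_act_prod; apply: eq_bigr => s _.
    by rewrite sp_sym_actC qinv.
  have -> : f = (p * Q')%:F / Q%:F.
    by rewrite fE; apply/eqP; rewrite tofrac_div_eq // QE -mulrA [Q' * q]mulrC.
  exists (average (p * Q')), Q; split=> //; last exact: averageFE.
    by exists (p * Q') => // A symA; rewrite sp_actM pinv // inv_prod.
  by apply/sym_poly_invariantsP; split=> //; apply: inv_prod.
move=> [p [q [/sym_poly_invariantsP[pinv sp] /sym_poly_invariantsP[qinv sq] q0
  ->]]].
exists (p%:F / q%:F); last by rewrite averageFE // average_fixed.
by move=> A symA; rewrite sp_actFE // pinv // qinv.
Qed.

Lemma sym_rat_invariants_sub f :
  sym_rat_invariants R n m f -> rat_invariants R n m f.
Proof.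
rewrite sym_rat_invariantsE => -[p [q [/sym_poly_invariantsP[pinv _]]]].
move=> /sym_poly_invariantsP[qinv _] q0 -> A symA.
by rewrite sp_actFE // pinv // qinv.
Qed.

(** The product runs over all ordered pairs, a set permuted by [S_m], whereas [pairs] in general is
    not. *)
Definition omega_poly : {poly polyV} :=
  \prod_(ij : 'I_m * 'I_m) ('X - (omega R n ij.1 ij.2)%:P).

Lemma omega_poly_coef i : sym_poly_invariants R n m omega_poly`_i.
Proof.
have mapE (f : {rmorphism polyV -> polyV}) : map_poly f omega_poly =
    \prod_(ij : 'I_m * 'I_m) ('X - (f (omega R n ij.1 ij.2))%:P).
  rewrite rmorph_prod; apply: eq_bigr => ij _.
  by rewrite rmorphB /= map_polyX map_polyC.
have coefE (f : {rmorphism polyV -> polyV}) :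
    \prod_(ij : 'I_m * 'I_m) ('X - (f (omega R n ij.1 ij.2))%:P) = omega_poly ->
  f omega_poly`_i = omega_poly`_i.
  by rewrite -mapE => fE; rewrite -[in RHS]fE coef_map.
apply/sym_poly_invariantsP; split=> [A symA|s].
  apply: (coefE (sp_rm A)); apply: eq_bigr => ij _.
  by rewrite [sp_rm A _](sp_act_omega _ _ symA).
apply: (coefE (pullback_rmorph (col_perm s (generic_point R n m)))).
rewrite /omega_poly [RHS](reindex (fun ij : 'I_m * 'I_m => (s ij.1, s ij.2))) /=.
  by apply: eq_bigr => ij _; rewrite [comp_mpoly _ _]sym_act_omega.
by exists (fun ij => (s^-1 ij.1, s^-1 ij.2)%g) => -[i' j'] _ /=;
  rewrite ?permK ?permKV.
Qed.

(** The forms [pair_omega] give the size, while the coefficients of [omega_poly] supply elements of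
    the symmetric field. Each form is a root of [omega_poly], hence algebraic over these
    coefficients. *)
Lemma sym_rat_invariants_trdeg :
  has_trdeg iota (sym_rat_invariants R n m) d.
Proof.
apply: (@has_trdeg_finite _ _ _ _ _ _ [seq c%:F | c <- (omega_poly : seq polyV)]
  (@alg_independent_pair_omega R n m)) => [x
    /sym_rat_invariants_sub/rat_invariants_genfield|_ /mapP[c cs ->]|k].
- exact: genfield_alg_closure.
- move/(nthP 0): cs => [i _ <-]; rewrite sym_rat_invariantsE.
  exists omega_poly`_i, 1; rewrite oner_neq0 tofrac1 divr1; split=> //.
    exact: omega_poly_coef.
  apply/sym_poly_invariantsP; split=> [A _|s]; last exact: sym_act1.
  exact: (rmorph1 (sp_rm A)).
apply/alg_closureP; exists (map_poly (@FracField.tofrac polyV) omega_poly).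
have Phi0 : omega_poly != 0 by rewrite monic_neq0 // monic_prod_XsubC.
split=> [|i|].
- by rewrite map_poly_eq0_id0 // tofrac_eq0 lead_coef_eq0.
- rewrite coef_map /=; have [i_lt|i_ge] := ltnP i (size omega_poly).
    by apply: mem_genfield; apply: map_f; apply: mem_nth.
  by rewrite nth_default // tofrac0 rpred0.
rewrite -[X in root _ X]/((@FracField.tofrac polyV) (pair_omega k)).
apply: rmorph_root; rewrite /omega_poly (bigD1 (enum_val k)) // rootM.
by rewrite root_XsubC eqxx.
Qed.
End MainProof.

Theorem theorem4p1 (R : realType) (n m : nat) (n_ge1 : (1 <= n)%N)
    (m_ge1 : (1 <= m)%N) :
  sym_rat_invariants R n m = fraction_field (sym_poly_invariants R n m) /\
  ((2 * n <= m)%N ->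
    has_trdeg (const_frac R ((n + n) * m)) (sym_rat_invariants R n m)
      (2 * n * m - n * (2 * n + 1))%N) /\
  ((m <= 2 * n)%N ->
    has_trdeg (const_frac R ((n + n) * m)) (sym_rat_invariants R n m)
      'C(m, 2)%N).
Proof.
split; first exact: sym_rat_invariantsE.
split=> nm.
  by rewrite -card_pairs_ge ?addnn -?mul2n //; apply: sym_rat_invariants_trdeg.
by rewrite -(@card_pairs_le n) ?addnn -?mul2n //; apply: sym_rat_invariants_trdeg.
Qed.
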